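(* Let $(\mu_t:t\ge0)$ be a generalized CDR model, with associated operators $(A_t:t\ge0)$ and inhomogeneous transition semigroup $(P_{r,t}:t\ge r\ge0)$. For any $t\ge0$ and $f\in\mathrm{b}\mathscr{C}^1_*(\mathbb{R}_+)$ the following backward integral equation holds: $$P_{r,t}f(x)=f(x)+\int_r^tA_sP_{s,t}f(x)\,\mathrm{d}s,\quad 0\le r\le t,\ x\in\mathbb{R}_+.$$
   Context: $\mathbb{R}_+=[0,\infty)$. $a\ge0$ is a fixed constant and $q=\{q_1,q_2,\dots\}$ is a fixed probability distribution on $\{1,2,\dots\}$. For a Borel probability measure $\mu$ on $\mathbb{R}_+$, $\mu^q=\sum_{i=1}^\infty q_i\mu^{*i}$ with $\mu^{*i}$ the $i$-fold convolution. $\langle\gamma,f\rangle=\int f\,\mathrm{d}\gamma$ and $T_cf(x)=f((x-c)_+)$ for $c,x\ge0$. $\mathrm{b}\mathscr{B}(\mathbb{R}_+)$ is the set of bounded Borel functions on $\mathbb{R}_+$; $\mathrm{b}\mathscr{C}^1(\mathbb{R}_+)$ is the set of bounded continuous functions on $\mathbb{R}_+$ with bounded continuous first derivative; $\mathrm{b}\mathscr{C}^1_*(\mathbb{R}_+)$ is the subset of those with $f'(0)=0$. A generalized CDR model is a family of Borel probability measures $(\mu_t:t\ge0)$ on $\mathbb{R}_+$ with $\partial_t\langle\mu_t,f\rangle=a\langle\mu_t*\mu_t^q-\mu_t,f\rangle-\langle\mu_t,f'1_{(0,\infty)}\rangle$, $t\ge0$, for every $f\in\mathrm{b}\mathscr{C}^1_*(\mathbb{R}_+)$.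 For $f\in\mathrm{b}\mathscr{C}^1(\mathbb{R}_+)$, $$A_tf(x)=a\int_{\mathbb{R}_+}[f(x+z)-f(x)]\,\mu_t^q(\mathrm{d}z)-f'(x)1_{\{x>0\}},\quad x\ge0.$$ For each $r\ge0$ and $x\ge0$, $(P_{r,t}(x,\cdot):t\ge r)$ is the unique family of Borel probability measures on $\mathbb{R}_+$ with $P_{r,r}(x,\cdot)=\delta_x$ such that $\nu_t=P_{r,t}(x,\cdot)$ satisfies, for every $f\in\mathrm{b}\mathscr{B}(\mathbb{R}_+)$, $$\langle\nu_t,f\rangle=\mathrm{e}^{a(r-t)}\langle\nu_r,T_{t-r}f\rangle+a\int_r^t\mathrm{e}^{a(s-t)}\langle\nu_s*\mu_s^q,T_{t-s}f\rangle\,\mathrm{d}s,\quad t\ge r.$$ The kernels $(P_{r,t})$ form an inhomogeneous Markov transition semigroup, and $P_{r,t}f(x)=\int_{\mathbb{R}_+}f(y)P_{r,t}(x,\mathrm{d}y)$. For $f\in\mathrm{b}\mathscr{C}^1_*(\mathbb{R}_+)$ one has $P_{s,t}f\in\mathrm{b}\mathscr{C}^1(\mathbb{R}_+)$, so that $A_sP_{s,t}f$ is defined. *)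

(* Defs.v *)
From HB Require Import structures.
From mathcomp Require Import all_boot all_order all_algebra.
From mathcomp Require Import all_classical all_reals all_analysis.
From mathcomp Require Import measurable_realfun.

Set Implicit Arguments.
Unset Strict Implicit.
Unset Printing Implicit Defensive.

Import Order.TTheory GRing.Theory Num.Theory.
Import numFieldNormedType.Exports.

Local Open Scope classical_set_scope.
Local Open Scope ring_scope.

(* The half-line is a subset of R rather than a type of its own: a function on
   it is a function R -> R whose values at negative arguments are never used,
   and a probability measure on it is a Borel probability measure on R that
   satisfies [on_Rplus]. *)
Definition Rplus (R : realType) : set R := `[0, +oo[.
Arguments Rplus {R}.

Notation borel_prob R := (probability (measurableTypeR R) R).

Definition on_Rplus (R : realType) (m : borel_prob R) : Prop :=
  m (Rplus : set (measurableTypeR R)) = 1%E.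

Definition pairing (R : realType) (m : borel_prob R) (f : R -> R) : R :=
  \int[m]_(x in (Rplus : set (measurableTypeR R))) f x.

Section convolution.
Context (R : realType).

Let add_pair (z : measurableTypeR R * measurableTypeR R) : measurableTypeR R :=
  (z.1 : R) + (z.2 : R).

Let measurable_add_pair : measurable_fun [set: _] add_pair.
Proof. exact: measurable_funD measurable_fst measurable_snd. Qed.

Variables m1 m2 : borel_prob R.

Definition convolution : set (measurableTypeR R) -> \bar R :=
  pushforward (m1 \x m2)%E add_pair.

Let convolution0 : convolution set0 = 0%E.
Proof. by rewrite /convolution /pushforward preimage_set0 measure0. Qed.

Let convolution_ge0 A : (0 <= convolution A)%E.
Proof. exact: measure_ge0. Qed.

Let convolution_sigma_additive : semi_sigma_additive convolution.
Proof.
move=> F mF tF mUF; rewrite /convolution /pushforward preimage_bigcup.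
apply: measure_semi_sigma_additive.
- by move=> n; rewrite -[X in measurable X]setTI; exact: measurable_add_pair.
- apply/trivIsetP => /= i j _ _ ij; rewrite -preimage_setI.
  by move/trivIsetP : tF => /(_ _ _ _ _ ij) ->//; rewrite preimage_set0.
- by rewrite -preimage_bigcup -[X in measurable X]setTI; exact: measurable_add_pair.
Qed.

HB.instance Definition _ := isMeasure.Build _ _ _ convolution
  convolution0 convolution_ge0 convolution_sigma_additive.

Let convolution_setT : convolution setT = 1%E.
Proof.
rewrite /convolution /pushforward preimage_setT -setXTT.
have -> : (m1 \x m2)%E (setT `*` setT) = (m1 setT * m2 setT)%E.
  exact: product_measure1E.
by rewrite !probability_setT mule1.
Qed.

HB.instance Definition _ := Measure_isProbability.Build _ _ _ convolution
  convolution_setT.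

Definition convolve : borel_prob R := convolution.

End convolution.

Definition conv_pow (R : realType) (m : borel_prob R) (i : nat) : borel_prob R :=
  iter i (convolve m) (\d_(0 : measurableTypeR R)).

(* probability distributions on {1, 2, ...} *)
Record posdist (R : realType) := PosDist {
  pmass :> nat -> R ;
  pmass_ge0 : forall i, 0 <= pmass i ;
  pmass0 : pmass 0%N = 0 ;
  pmass_sum1 : (\sum_(1 <= i <oo) (pmass i)%:E = 1)%E }.

Section mixture.
Context (R : realType) (q : posdist R) (m : borel_prob R).

Definition mixture : set (measurableTypeR R) -> \bar R :=
  mseries (fun i => mscale (NngNum (pmass_ge0 q i)) (conv_pow m i)) 1.

HB.instance Definition _ := Measure.on mixture.

Let mixture_setT : mixture setT = 1%E.
Proof.
rewrite /mixture /mseries -(pmass_sum1 q).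
apply: eq_eseriesr => i _.
transitivity ((q i)%:E * conv_pow m i setT)%E; first by [].
by rewrite probability_setT mule1.
Qed.

HB.instance Definition _ := Measure_isProbability.Build _ _ _ mixture
  mixture_setT.

(* m^q, the sum over i >= 1 of q_i m^{*i} *)
Definition qmix : borel_prob R := mixture.

End mixture.

Section halfline_functions.
Context (R : realType).
Implicit Types f : R -> R.

Definition bounded_Rplus f : Prop :=
  exists M : R, forall x, Rplus x -> `|f x| <= M.

Definition bBorel f : Prop :=
  measurable_fun (Rplus : set (measurableTypeR R))
    (f : measurableTypeR R -> measurableTypeR R) /\ bounded_Rplus f.

(* Difference quotient at x along points of the half-line: its limit is the
   two-sided derivative when x > 0 and the right derivative when x = 0. *)
Definition is_deriv_Rplus f (x l : R) : Prop :=
  (f y - f x) / (y - x) @[y --> within Rplus x^'] --> l.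

Definition deriv_Rplus f (x : R) : R :=
  lim ((f y - f x) / (y - x) @[y --> within Rplus x^']).

Definition bC1 f : Prop :=
  [/\ bounded_Rplus f,
      {within Rplus, continuous f},
      forall x, Rplus x -> is_deriv_Rplus f x (deriv_Rplus f x),
      bounded_Rplus (deriv_Rplus f) &
      {within Rplus, continuous (deriv_Rplus f)}].

Definition bC1_star f : Prop := bC1 f /\ deriv_Rplus f 0 = 0.

Definition shift_op (c : R) f : R -> R := fun x => f (Num.max (x - c) 0).

End halfline_functions.

Section CDR.
Context (R : realType) (a : R) (q : posdist R).
Implicit Type mu : R -> borel_prob R.

(* families indexed by t >= 0 are functions of t : R, unconstrained at t < 0 *)
Definition generalized_CDR mu : Prop :=
  (forall t, 0 <= t -> on_Rplus (mu t)) /\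
  (forall f, bC1_star f -> forall t, 0 <= t ->
     is_deriv_Rplus (fun s => pairing (mu s) f) t
       (a * (pairing (convolve (mu t) (qmix q (mu t))) f - pairing (mu t) f)
        - pairing (mu t) (fun x => deriv_Rplus f x * (0 < x)%R%:R))).

Definition generator mu (t : R) (f : R -> R) (x : R) : R :=
  a * pairing (qmix q (mu t)) (fun z => f (x + z) - f x)
  - deriv_Rplus f x * (0 < x)%R%:R.

(* The integrand in s is required to be Lebesgue integrable because the
   library's integral is total, also at non-measurable integrands. *)
Definition mild_solution mu (r : R) (nu : R -> borel_prob R) : Prop :=
  forall f, bBorel f -> forall t, r <= t ->
    let g s := expR (a * (s - t)) *
               pairing (convolve (nu s) (qmix q (mu s))) (shift_op (t - s) f) in
    lebesgue_measure.-integrable `[r, t] (EFin \o g) /\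
    pairing (nu t) f =
      expR (a * (r - t)) * pairing (nu r) (shift_op (t - r) f)
      + a * \int[lebesgue_measure]_(s in `[r, t]) g s.

(* P r t x is the measure P_{r,t}(x, .) *)
Definition transition_family mu (P : R -> R -> R -> borel_prob R) : Prop :=
  forall r x, 0 <= r -> 0 <= x ->
    [/\ forall t, r <= t -> on_Rplus (P r t x),
        forall B, measurable B -> P r r x B = \d_x B &
        mild_solution mu r (fun t => P r t x)].

Definition transition_op (P : R -> R -> R -> borel_prob R) (r t : R)
  (f : R -> R) : R -> R := fun x => pairing (P r t x) f.

End CDR.

(* Main.v *)
From HB Require Import structures.
Require Import Defs.
From mathcomp Require Import all_boot all_order all_algebra.
From mathcomp Require Import all_classical all_reals all_analysis.
From mathcomp Require Import measurable_realfun ring lra.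
Set Implicit Arguments.
Unset Strict Implicit.
Unset Printing Implicit Defensive.
Import Order.TTheory GRing.Theory Num.Theory.
Import numFieldNormedType.Exports.
Local Open Scope classical_set_scope.
Local Open Scope ring_scope.

(** Write T for the final time, and let the process descend at unit speed, stop
    at the origin, and jump at rate a, at time v by an amount of law sigma_v, the
    mixture of the convolution powers of mu_v. Decomposing a path at its first
    jump after s suggests that u(s, y) = P_{s,T} f(y) is the fixed point of

      u(s, y) = e^{-a(T-s)} f((y-(T-s))_+)
                + int_s^T a e^{-a(v-s)} (K_v u)((y-(v-s))_+) dv,

    where K_v u(y) is the mean of u(v, y + z) under sigma_v(dz). The right-hand
    side is a contraction of rate 1 - e^{-aT} for the uniform norm; let U_n be its
    iterates ([picard], [iterate]).

    The U_n are C^1 in y. Their derivatives W_n are the iterates of the same map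
    with f' in place of f and with the process killed at the origin
    ([picard_has_deriv]): the positive part has its kink at a single time v, and
    f'(0) = 0 makes the constant extension of f to the negative half-line C^1.

    The semigroup is only given by the forward equation, so the limit of U_n has
    to be identified. For nu_s = P_{r,s}(x, .), two uses of the forward equation
    and Fubini show that the integral of f against nu_T differs from U_{n+1}(r, x)
    by a time integral of the mean of U_{n+1} - U_n after a jump ([duality]),
    which tends to 0. Hence U_n converges uniformly to P_{s,T} f, and W_n
    uniformly to its derivative, which vanishes at the origin. Fubini requires that
    s |-> nu_s and s |-> sigma_s be kernels, which follows from their equations
    tested on smooth approximations of indicators of rays
    ([meas_family_jump_law], [meas_family_path]).

    Each step of the iteration satisfies a backward equation exactly,

      U_{n+1}(r, x) = f(x) + int_r^T (a K_s U_n - a U_{n+1} - W_{n+1})(s, x) ds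

    ([backward_step]), by the fundamental theorem of calculus along the stopped
    drift ([kink_FTC]) for each jump time v, and Fubini. Dominated convergence then
    gives the theorem, the integrand converging to A_s P_{s,T} f(x). *)

(** * Bounded measurable functions *)

(** Such functions are closed under all the operations used below and are
    integrable against every finite measure, so that integrals can be
    manipulated without any integrability side condition. *)
Definition bdm d (T : measurableType d) (R : realType) (g : T -> R) :=
  measurable_fun setT g /\ exists M : R, forall x, `|g x| <= M.

Section bounded_measurable.
Context {d} {T : measurableType d} {R : realType}.
Implicit Types g h : T -> R.

Lemma bdm_cst (c : R) : bdm (fun _ : T => c).
Proof. by split; [exact: measurable_cst|exists `|c|]. Qed.

Lemma bdmD g h : bdm g -> bdm h -> bdm (fun x => g x + h x).
Proof.
move=> [mg [/= M gM]] [mh [N hN]]; split; first exact: measurable_funD.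
exists (M + N) => x; apply: (le_trans (ler_normD _ _)); exact: lerD.
Qed.

Lemma bdmB g h : bdm g -> bdm h -> bdm (fun x => g x - h x).
Proof.
move=> [mg [/= M gM]] [mh [N hN]]; split; first exact: measurable_funB.
exists (M + N) => x; apply: (le_trans (ler_normB _ _)); exact: lerD.
Qed.

Lemma bdmM g h : bdm g -> bdm h -> bdm (fun x => g x * h x).
Proof.
move=> [mg [/= M gM]] [mh [N hN]]; split; first exact: measurable_funM.
by exists (M * N) => x; rewrite normrM ler_pM.
Qed.

Lemma measurable_bool (b : T -> bool) :
  measurable_fun setT b -> measurable_fun setT (fun x => (b x)%:R : R).
Proof. by move=> mb; apply: (measurableT_comp (f := fun c : bool => c%:R : R)). Qed.

Lemma bdm_bool (b : T -> bool) :
  measurable_fun setT b -> bdm (fun x => (b x)%:R : R).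
Proof.
move=> mb; split; first exact: measurable_bool.
by exists 1 => x; case: (b x); rewrite ?normr1 ?normr0.
Qed.

Lemma bdm_comp d' (T' : measurableType d') (g : T' -> R) (phi : T -> T') :
  measurable_fun setT phi -> bdm g -> bdm (fun x => g (phi x)).
Proof.
by move=> mphi [mg [/= M gM]]; split; [exact: measurableT_comp|exists M].
Qed.

Lemma bdm_cvg (gn : nat -> T -> R) g (M : R) :
  (forall n, measurable_fun setT (gn n)) -> (forall n x, `|gn n x| <= M) ->
  (forall x, gn n x @[n --> \oo] --> g x) -> bdm g.
Proof.
move=> mg gM cg; split.
  by apply: (measurable_fun_cvg (h := gn)) => // x _; exact: cg.
exists M => x.
rewrite -(cvg_lim _ (cvg_norm (cg x)))//.
by apply: limr_le; [apply/cvg_ex; eexists; exact: (cvg_norm (cg x))|exact: nearW].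
Qed.

End bounded_measurable.

Section finite_measure_calculus.
Context {d} {T : measurableType d} {R : realType}.
Variable m : {finite_measure set T -> \bar R}.
Implicit Types (g h : T -> R) (D : set T).

Lemma bdm_integrable g D : measurable D -> bdm g -> m.-integrable D (EFin \o g).
Proof.
move=> mD [mg [/= M gM]]; apply: measurable_bounded_integrable => //.
- by rewrite -ge0_fin_numE// fin_num_measure.
- exact: measurable_funTS.
- exists M; split; first exact: num_real.
  by move=> y My x _ /=; rewrite (le_trans (gM x))// ltW.
Qed.

Lemma bdmIT g : bdm g -> m.-integrable setT (EFin \o g).
Proof. exact: bdm_integrable. Qed.

Lemma bdm_intD g h : bdm g -> bdm h ->
  \int[m]_x (g x + h x) = \int[m]_x g x + \int[m]_x h x.
Proof. by move=> bg bh; rewrite RintegralD//; exact: bdmIT. Qed.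

Lemma bdm_intB g h : bdm g -> bdm h ->
  \int[m]_x (g x - h x) = \int[m]_x g x - \int[m]_x h x.
Proof. by move=> bg bh; rewrite RintegralB//; exact: bdmIT. Qed.

Lemma bdm_intZl (c : R) g : bdm g -> \int[m]_x (c * g x) = c * \int[m]_x g x.
Proof. by move=> bg; rewrite RintegralZl//; exact: bdmIT. Qed.

Lemma bdm_le g h : bdm g -> bdm h -> (forall x, g x <= h x) ->
  \int[m]_x g x <= \int[m]_x h x.
Proof. by move=> bg bh gh; apply: le_Rintegral => //; exact: bdmIT. Qed.

Lemma bdm_norm_le g h : bdm g -> bdm h -> (forall x, `|g x| <= h x) ->
  `|\int[m]_x g x| <= \int[m]_x h x.
Proof.
move=> bg bh gh; apply: le_trans (le_normr_Rintegral _ (bdmIT bg)) _ => //.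
apply: le_Rintegral => //; [|exact: bdmIT].
case: bg => mg [M gM]; apply: bdmIT; split; first exact: measurableT_comp.
by exists M => x; rewrite normr_id.
Qed.

Lemma int_norm_le_cst g (M : R) : bdm g -> (forall x, `|g x| <= M) ->
  `|\int[m]_x g x| <= M * fine (m setT).
Proof.
by move=> bg gM; rewrite -Rintegral_cst//; apply: bdm_norm_le => //; exact: bdm_cst.
Qed.

Lemma bdm_cvg_int (gn : nat -> T -> R) g (M : R) :
  (forall n, measurable_fun setT (gn n)) -> measurable_fun setT g ->
  (forall n x, `|gn n x| <= M) ->
  {ae m, forall x, gn n x @[n --> \oo] --> g x} ->
  \int[m]_x gn n x @[n --> \oo] --> \int[m]_x g x.
Proof.
move=> mgn mg gM cg.
have [|||||ig _ cvg_int] := @dominated_convergence _ _ _ m _ measurableT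
  (fun n => EFin \o gn n) (EFin \o g) (fun=> M%:E).
- by move=> n; apply/measurable_EFinP.
- exact/measurable_EFinP.
- apply: filterS cg => x cx _; apply: cvg_EFin; [exact: nearW|exact: cx].
- exact: (bdmIT (bdm_cst M)).
- by apply: aeW => x n _; rewrite /= lee_fin.
rewrite /Rintegral; apply: fine_cvg; rewrite fineK//.
exact: integrable_fin_num.
Qed.

Lemma ae_mono (P Q : T -> Prop) :
  (forall x, P x -> Q x) -> {ae m, forall x, P x} -> {ae m, forall x, Q x}.
Proof. by move=> PQ; exact: filterS. Qed.

(** Dominated convergence along a real parameter, through sequences. *)
Lemma bdm_dnbhs_int (F : R -> T -> R) (G : T -> R) a (M : R) :
  (forall x, measurable_fun setT (F x)) -> measurable_fun setT G ->
  (forall x y, x != a -> `|F x y| <= M) ->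
  {ae m, forall y, F x y @[x --> a^'] --> G y} ->
  \int[m]_y F x y @[x --> a^'] --> \int[m]_y G y.
Proof.
move=> mF mG FM cF; apply/cvgr_dnbhsP => u [ua cu].
apply: (@bdm_cvg_int (fun n => F (u n)) _ M) => //.
  by move=> n x; exact: FM.
apply: filterS cF => y /cvgr_dnbhsP; exact.
Qed.

End finite_measure_calculus.

Lemma prob_int_norm_le d (T : measurableType d) (R : realType)
    (P : probability T R) (g : T -> R) (M : R) :
  bdm g -> (forall x, `|g x| <= M) -> `|\int[P]_x g x| <= M.
Proof.
move=> bg gM; have := @int_norm_le_cst _ _ _ P g M bg gM.
have -> : fine (P setT) = 1 by rewrite probability_setT.
by rewrite mulr1.
Qed.

Section fubini_bounded.
Context {d d'} {X : measurableType d} {Y : measurableType d'} {R : realType}.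

Lemma bdm_fubini (m1 : {finite_measure set X -> \bar R})
    (m2 : {finite_measure set Y -> \bar R}) (g : X -> Y -> R) :
  bdm (fun z : X * Y => g z.1 z.2) ->
  \int[m1]_x \int[m2]_y g x y = \int[m2]_y \int[m1]_x g x y.
Proof.
move=> bg; have [mg [/= M gM]] := bg.
have b1 x : bdm (g x).
  by apply: (bdm_comp (g := fun z => g z.1 z.2) (phi := fun y => (x, y)) (pair1_measurable x)).
have b2 y : bdm (g ^~ y).
  by apply: (bdm_comp (g := fun z => g z.1 z.2) (phi := fun x => (x, y)) (pair2_measurable y)).
have := @Fubini _ _ X Y R m1 m2 (fun z => (g z.1 z.2)%:E) => H.
rewrite /Rintegral; congr fine.
transitivity (\int[m1]_x \int[m2]_y (g x y)%:E)%E.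
  by apply: eq_integral => x _; rewrite fineK//; exact/integrable_fin_num/bdmIT.
rewrite H.
  by apply: eq_integral => y _; rewrite fineK//; exact/integrable_fin_num/bdmIT.
have M0 : 0 <= M := le_trans (normr_ge0 _) (gM (point, point)).
apply/integrable12ltyP; first exact/measurable_EFinP.
apply: (@le_lt_trans _ _ (\int[m1]_x (M%:E * m2 setT))%E).
  apply: ge0_le_integral => //.
  - by move=> x _; exact: integral_ge0.
  - apply: (measurable_fun_fubini_tonelli_F (m2 := m2)
      (fun z => `|(g z.1 z.2)%:E|%E)) => //.
    by apply: measurableT_comp => //; exact/measurable_EFinP.
  - move=> x _; rewrite -integral_cst//; apply: ge0_le_integral => //.
    + by apply: measurableT_comp => //; apply/measurable_EFinP; case: (b1 x).
    + by move=> y _; rewrite /= lee_fin (gM (x, y)).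
rewrite integral_cst//.
by rewrite -ge0_fin_numE ?fin_numM ?fin_num_measure// !mule_ge0.
Qed.

End fubini_bounded.

(** * Measurable families of probability measures *)

Section probability_family.
Context {d d'} {X : measurableType d} {Y : measurableType d'} {R : realType}.

(** Unbundled kernels: the families of measures met below are plain functions of
    the time, and their measurability is something to prove. *)
Definition meas_family (l : X -> probability Y R) :=
  forall U, measurable U -> measurable_fun setT (fun x => l x U).

Section kernel_of_family.
Variable l : X -> probability Y R.

Definition family_kernel (ml : meas_family l) : X -> {measure set Y -> \bar R} :=
  fun x => l x.

Hypothesis ml : meas_family l.

HB.instance Definition _ := @isKernel.Build _ _ X Y R (family_kernel ml) ml.

Let family_kernel_setT x : family_kernel ml x setT = 1%E.
Proof. exact: probability_setT. Qed.

HB.instance Definition _ :=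
  @Kernel_isProbability.Build _ _ X Y R (family_kernel ml) family_kernel_setT.

End kernel_of_family.

Lemma measurable_xsection_family (l : X -> probability Y R) (A : set (X * Y)) :
  meas_family l -> measurable A ->
  measurable_fun setT (fun x => l x (xsection A x)).
Proof.
move=> ml mA.
pose k : R.-fker X ~> Y := family_kernel ml.
by apply: (measurable_fun_xsection_finite_kernel k); rewrite inE.
Qed.

Lemma bdm_family_int (l : X -> probability Y R) (g : X -> Y -> R) :
  meas_family l -> bdm (fun z : X * Y => g z.1 z.2) ->
  bdm (fun x => \int[l x]_y g x y).
Proof.
move=> ml bg; have [mg [/= M gM]] := bg.
have b1 x : bdm (g x).
  by apply: (bdm_comp (g := fun z => g z.1 z.2) (phi := fun y => (x, y)) (pair1_measurable x)).
split; last first.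
  by exists M => x; apply: prob_int_norm_le => // y; exact: (gM (x, y)).
pose k : R.-fker X ~> Y := family_kernel ml.
rewrite /Rintegral; apply: measurableT_comp; first exact: fine_measurable.
under eq_fun do rewrite integralE.
have mE : measurable_fun setT (fun z : X * Y => (g z.1 z.2)%:E).
  exact/measurable_EFinP.
apply: emeasurable_funB.
- rewrite (_ : (fun x => _) =
    (fun x => \int[l x]_y ((fun z : X * Y => (g z.1 z.2)%:E)^\+) (x, y))%E);
    last by apply/funext => x; apply: eq_integral => y _; rewrite !funeposE.
  apply: (measurable_fun_integral_finite_kernel
    ((fun z : X * Y => (g z.1 z.2)%:E)^\+)%E k) => //.
  exact: measurable_funepos.
- rewrite (_ : (fun x => _) =
    (fun x => \int[l x]_y ((fun z : X * Y => (g z.1 z.2)%:E)^\-) (x, y))%E);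
    last by apply/funext => x; apply: eq_integral => y _; rewrite !funenegE.
  apply: (measurable_fun_integral_finite_kernel
    ((fun z : X * Y => (g z.1 z.2)%:E)^\-)%E k) => //.
  exact: measurable_funeneg.
Qed.

Lemma bdm_int_param (m : {finite_measure set Y -> \bar R}) (g : X -> Y -> R) :
  bdm (fun z : X * Y => g z.1 z.2) -> bdm (fun x => \int[m]_y g x y).
Proof.
move=> bg; have [mg [/= M gM]] := bg.
have b1 x : bdm (g x).
  by apply: (bdm_comp (g := fun z => g z.1 z.2) (phi := fun y => (x, y)) (pair1_measurable x)).
split; last first.
  exists (M * fine (m setT)) => x.
  by apply: int_norm_le_cst => // y; exact: (gM (x, y)).
rewrite /Rintegral; apply: measurableT_comp; first exact: fine_measurable.
under eq_fun do rewrite integralE.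
have mE : measurable_fun setT (fun z : X * Y => (g z.1 z.2)%:E).
  exact/measurable_EFinP.
apply: emeasurable_funB.
- rewrite (_ : (fun x => _) =
    (fun x => \int[m]_y ((fun z : X * Y => (g z.1 z.2)%:E)^\+) (x, y))%E);
    last by apply/funext => x; apply: eq_integral => y _; rewrite !funeposE.
  apply: (measurable_fun_fubini_tonelli_F (m2 := m)
    ((fun z : X * Y => (g z.1 z.2)%:E)^\+)%E) => //.
  exact: measurable_funepos.
- rewrite (_ : (fun x => _) =
    (fun x => \int[m]_y ((fun z : X * Y => (g z.1 z.2)%:E)^\-) (x, y))%E);
    last by apply/funext => x; apply: eq_integral => y _; rewrite !funenegE.
  apply: (measurable_fun_fubini_tonelli_F (m2 := m)
    ((fun z : X * Y => (g z.1 z.2)%:E)^\-)%E) => //.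
  exact: measurable_funeneg.
Qed.

End probability_family.

(** * Measures on the half-line and their convolutions *)

Section half_line.
Context {R : realType}.
Implicit Types (f g h : R -> R) (m : borel_prob R).

Lemma measurable_Rplus : measurable (Rplus : set R).
Proof. exact: measurable_itv. Qed.

Lemma measurable_pos : measurable_fun setT (fun x : R => Num.max x 0).
Proof. by apply: measurable_maxr. Qed.

Lemma Rplus_pos (x : R) : Rplus (Num.max x 0).
Proof. by rewrite /Rplus /= in_itv/= andbT le_max lexx orbT. Qed.

Lemma Rplus_ge0 (x : R) : Rplus x = (0 <= x) :> Prop.
Proof. by rewrite /Rplus /= in_itv/= andbT. Qed.

Lemma on_Rplus_negligible m : on_Rplus m -> m (~` (Rplus : set (measurableTypeR R))) = 0%E.
Proof.
move=> hm; rewrite probability_setC; last exact: measurable_Rplus.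
have -> : m (Rplus : set (measurableTypeR R)) = 1%E by exact: hm.
by rewrite subee.
Qed.

Lemma on_Rplus_ae m : on_Rplus m -> {ae m, forall x, Rplus x}.
Proof.
move=> hm; exists (~` (Rplus : set (measurableTypeR R))); split => //.
- by apply: measurableC; exact: measurable_Rplus.
- exact: on_Rplus_negligible.
Qed.

Lemma on_Rplus_int m g h : on_Rplus m -> bdm g -> bdm h ->
  (forall x, 0 <= x -> g x = h x) -> \int[m]_x g x = \int[m]_x h x.
Proof.
move=> hm bg bh gh; rewrite /Rintegral; congr fine; apply: ae_eq_integral => //.
- by case: bg => mg _; exact/measurable_EFinP.
- by case: bh => mh _; exact/measurable_EFinP.
- have F := ae_filter_ringOfSetsType m.
  by apply: filterS (on_Rplus_ae hm) => x; rewrite Rplus_ge0 => x0 _; rewrite gh.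
Qed.

Lemma bBorel_pos f : bBorel f -> bdm (fun x : R => f (Num.max x 0)).
Proof.
move=> [mf [M fM]]; split; last by exists M => x; apply: fM; exact: Rplus_pos.
apply: (@measurable_comp _ _ _ _ _ _ (Rplus : set R) f setT (fun x : R => Num.max x 0)).
- exact: measurable_Rplus.
- by move=> _ /= [x _ <-]; exact: Rplus_pos.
- exact: mf.
- exact: measurable_pos.
Qed.

Lemma bdm_bBorel f : bdm f -> bBorel f.
Proof.
move=> [mf [M fM]]; split; last by exists M.
by apply: measurable_funTS; exact: mf.
Qed.

(** A function on the half-line is read at the positive part of its argument,
    which makes it a function on the whole line with the same integrals. *)
Lemma pairing_posE m f : on_Rplus m -> bBorel f ->
  pairing m f = \int[m]_x f (Num.max x 0).
Proof.
move=> hm bf; have bp := bBorel_pos bf.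
rewrite /pairing; transitivity
  (\int[m]_(x in (Rplus : set (measurableTypeR R))) f (Num.max x 0)).
  apply: eq_Rintegral => x; rewrite inE Rplus_ge0 => x0.
  by rewrite max_l.
rewrite /Rintegral [in RHS](@negligible_integral _ _ _ m setT
  (~` (Rplus : set (measurableTypeR R)))).
- by rewrite setDE setTI setCK.
- by apply: measurableC; exact: measurable_Rplus.
- exact: measurableT.
- exact: bdmIT.
- exact: on_Rplus_negligible.
Qed.

Lemma pairingE m f : on_Rplus m -> bdm f -> pairing m f = \int[m]_x f x.
Proof.
move=> hm bf; rewrite pairing_posE//; last exact: bdm_bBorel.
apply: on_Rplus_int => //.
- by apply: bdm_comp => //; exact: measurable_pos.
- by move=> x x0; rewrite max_l.
Qed.

Lemma on_Rplus_conv m1 m2 :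
  on_Rplus m1 -> on_Rplus m2 -> on_Rplus (convolve m1 m2).
Proof.
rewrite /on_Rplus => h1 h2; apply/eqP; rewrite eq_le probability_le1/=; last exact: measurable_Rplus.
have mR := measurable_Rplus.
have madd : measurable_fun [set: measurableTypeR R * measurableTypeR R]
    (fun z => (z.1 : R) + z.2 : measurableTypeR R).
  exact: measurable_funD measurable_fst measurable_snd.
have <- : (m1 \x m2)%E ((Rplus : set (measurableTypeR R)) `*`
    (Rplus : set (measurableTypeR R))) = 1%E.
  transitivity (m1 (Rplus : set (measurableTypeR R)) *
      m2 (Rplus : set (measurableTypeR R)))%E; first exact: product_measure1E.
  by rewrite h1 h2 mule1.
rewrite /= /convolution /pushforward; apply: le_measure; rewrite ?inE.
- exact: measurableX.
- by rewrite -[X in measurable X]setTI; exact: madd.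
- by move=> [x y] /= []; rewrite !Rplus_ge0; exact: addr_ge0.
Qed.

Lemma on_Rplus_conv_pow m i : on_Rplus m -> on_Rplus (conv_pow m i).
Proof.
move=> hm; elim: i => [|i IH]; last exact: on_Rplus_conv.
rewrite /on_Rplus /conv_pow /= /dirac indicE mem_set//.
by rewrite Rplus_ge0.
Qed.

Lemma on_Rplus_qmix (q : posdist R) m : on_Rplus m -> on_Rplus (qmix q m).
Proof.
move=> hm; rewrite /on_Rplus /qmix /= /mixture /mseries -(pmass_sum1 q).
apply: eq_eseriesr => i _.
transitivity ((q i)%:E * conv_pow m i (Rplus : set (measurableTypeR R)))%E => //.
have -> : conv_pow m i (Rplus : set (measurableTypeR R)) = 1%E.
  exact: on_Rplus_conv_pow.
by rewrite mule1.
Qed.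

Lemma convolve_int m1 m2 g : bdm g ->
  \int[convolve m1 m2]_x g x = \int[m1]_y \int[m2]_z g (y + z).
Proof.
move=> bg.
have madd : measurable_fun [set: measurableTypeR R * measurableTypeR R]
    (fun z => (z.1 : R) + z.2 : measurableTypeR R).
  exact: measurable_funD measurable_fst measurable_snd.
have badd : bdm (fun z : measurableTypeR R * measurableTypeR R => g (z.1 + z.2)).
  exact: (bdm_comp madd).
have m1T : ((m1 \x m2) setT = 1)%E.
  rewrite -setXTT; transitivity (m1 setT * m2 setT)%E.
    exact: product_measure1E.
  by rewrite !probability_setT mule1.
have ii : (m1 \x m2)%E.-integrable setT
    (EFin \o (fun z : measurableTypeR R * measurableTypeR R => g (z.1 + z.2))).
  have [mg [M gM]] := badd.
  have szT : ((m1 \x m2) setT < +oo)%E by rewrite m1T ltry.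
  apply: (measurable_bounded_integrable measurableT szT mg).
  exists M; split; first exact: num_real.
  by move=> y My x _ /=; rewrite (le_trans (gM x))// ltW.
rewrite /Rintegral /=; congr fine.
transitivity (\int[(m1 \x m2)%E]_z
    (EFin \o (fun z : measurableTypeR R * measurableTypeR R => g (z.1 + z.2)%R)) z)%E.
  rewrite (_ : convolution m1 m2 = pushforward (m1 \x m2)%E
    (fun z : measurableTypeR R * measurableTypeR R => (z.1 + z.2)%R : measurableTypeR R))//.
  have mg : measurable_fun setT (EFin \o g : measurableTypeR R -> \bar R).
    by case: bg => mg _; exact/measurable_EFinP.
  exact: (integral_pushforward madd mg ii measurableT).
rewrite -(integral12_prod_meas1 ii); apply: eq_integral => y _.
rewrite /fubini_F /= fineK//; apply: integrable_fin_num => //; apply: bdmIT.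
apply: (bdm_comp (phi := fun z : R => y + z)) bg.
exact: measurable_funD.
Qed.

End half_line.

Section measurable_convolution.
Context {R : realType} {d} {X : measurableType d}.

(** The convolution of a set U is the integral over y of the measure of the
    section U - y, hence an integral of a kernel against a kernel. *)
Lemma meas_family_convolve (l1 l2 : X -> borel_prob R) :
  meas_family l1 -> meas_family l2 ->
  meas_family (fun x => convolve (l1 x) (l2 x)).
Proof.
move=> h1 h2 U mU.
have madd : measurable_fun [set: measurableTypeR R * measurableTypeR R]
    (fun z => (z.1 : R) + z.2 : measurableTypeR R).
  exact: measurable_funD measurable_fst measurable_snd.
pose A := (fun z : measurableTypeR R * measurableTypeR R =>
  (z.1 : R) + z.2 : measurableTypeR R) @^-1` U.
have mA : measurable A by rewrite -[A]setTI; exact: madd.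
rewrite (_ : (fun x => _) =
    (fun x => \int[l1 x]_y l2 x (xsection A y))%E) //.
pose l2' := fun z : X * measurableTypeR R => l2 z.1.
have ml2 : meas_family l2'.
  by move=> V mV; apply: (measurableT_comp (h2 V mV)); exact: measurable_fst.
pose k : R.-fker X ~> measurableTypeR R := family_kernel h1.
pose B : set ((X * measurableTypeR R) * measurableTypeR R) :=
  (fun z => (z.1.2, z.2)) @^-1` A.
have mB : measurable B.
  rewrite -[B]setTI; apply: (measurable_fun_pair (f := fun z => z.1.2) (g := snd)) => //.
  exact: measurableT_comp measurable_snd measurable_fst.
apply: (measurable_fun_integral_finite_kernel
  (fun z : X * measurableTypeR R => l2' z (xsection B z)) k) => //.
exact: measurable_xsection_family.
Qed.

Lemma meas_family_conv_pow (l : X -> borel_prob R) i :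
  meas_family l -> meas_family (fun x => conv_pow (l x) i).
Proof.
move=> hl; elim: i => [|i IH]; first by move=> U mU; exact: measurable_cst.
exact: meas_family_convolve.
Qed.

Lemma meas_family_qmix (q : posdist R) (l : X -> borel_prob R) :
  meas_family l -> meas_family (fun x => qmix q (l x)).
Proof.
move=> hl U mU.
rewrite (_ : (fun x => _) = (fun x =>
  \sum_(1 <= i <oo) ((q i)%:E * conv_pow (l x) i U))%E)//.
rewrite (_ : (fun x => _) = (fun x =>
  \sum_(0 <= i <oo | (0 < i)%N) ((q i)%:E * conv_pow (l x) i U))%E).
  apply: ge0_emeasurable_sum => [i x _ _|i _].
    by rewrite mule_ge0// lee_fin pmass_ge0.
  by apply: measurable_funeM; exact: meas_family_conv_pow.
by apply/funext => x; rewrite eseries_cond/=; exact: eq_eseriesl.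
Qed.

End measurable_convolution.

Section ray_criterion.
Context {R : realType} {d} {X : measurableType d}.

(** The open right rays form a pi-system generating the Borel sets, and the sets
    whose measure depends measurably on x form a Dynkin system. *)
Lemma meas_family_rays (l : X -> borel_prob R) :
  (forall b : R, measurable_fun setT (fun x => l x `]b, +oo[%classic)) ->
  meas_family l.
Proof.
move=> hr U mU.
pose Q := fun S : set (measurableTypeR R) => measurable_fun setT (fun x => l x S).
have mE : @measurable _ (measurableTypeR R) = <<s @RGenOInfty.G R >>.
  exact: RGenOInfty.measurableE.
apply: (@dynkin_induction _ (measurableTypeR R) (@RGenOInfty.G R) Q mE) => //.
- move=> _ _ [a ->] [b ->]; exists (Num.max a b).
  apply/seteqP; split => x /=; rewrite !in_itv/= !andbT gt_max.
    by move=> [-> ->].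
  by move/andP.
- rewrite /Q (_ : (fun x => _) = cst 1%E); first exact: measurable_cst.
  by apply/funext => x; exact: probability_setT.
- by move=> _ [b ->]; exact: hr.
- move=> S mS QS; rewrite /Q; under eq_fun do rewrite (probability_setC _ mS).
  by apply: emeasurable_funB.
- move=> F mF tF QF; rewrite /Q.
  rewrite (_ : (fun x => _) = (fun x => \sum_(0 <= k <oo) l x (F k))%E).
    apply: ge0_emeasurable_sum => [k x _ _|k _]; first exact: measure_ge0.
    exact: QF.
  apply/funext => x; rewrite measure_bigcup//.
  by apply: eq_eseriesl => i; rewrite in_setT.
- by rewrite -mE.
Qed.

End ray_criterion.

(** * Derivatives on the line and on the half-line *)

Section difference_quotients.
Context {R : realType}.
Implicit Types F G : R -> R.

(** Differentiability through the same difference quotient as [is_deriv_Rplus], so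
    that a two-sided derivative restricts to the half-line at once. A record
    rather than a plain convergence statement: the latter unfolds to a
    quantification over neighbourhoods, which obscures the number of
    arguments of a lemma. *)
Record has_deriv F (x l : R) : Prop := HasDeriv {
  has_deriv_cvg : (F y - F x) / (y - x) @[y --> x^'] --> l }.

Lemma has_derivP F (x l : R) : has_deriv F x l <-> is_derive x 1 F l.
Proof.
split=> [[h]|[dF FE]].
  have hc : h^-1 *: (F (h *: 1 + x) - F x) @[h --> 0^'] --> l.
    apply/cvgr_dnbhsP => u [un0 cu].
    move/cvgr_dnbhsP : h => /(_ (fun n => u n + x)) h.
    have : (forall n, u n + x != x) /\ (u n + x) @[n --> \oo] --> x.
      split; first by move=> n; rewrite -subr_eq0 addrK.
      by rewrite -[X in _ --> X]add0r; apply: cvgD => //; exact: cvg_cst.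
    move/h; apply: cvg_trans; apply: near_eq_cvg; apply: nearW => n /=.
    by rewrite addrK /GRing.scale/= mulr1 mulrC.
  apply: DeriveDef; first by apply/cvg_ex; exists l.
  exact/cvg_lim.
have hc : h^-1 *: (F (h *: 1 + x) - F x) @[h --> 0^'] --> l.
  by rewrite -FE; exact: dF.
split; apply/cvgr_dnbhsP => u [un0 cu].
move/cvgr_dnbhsP : hc => /(_ (fun n => u n - x)) h.
have : (forall n, u n - x != 0) /\ (u n - x) @[n --> \oo] --> 0.
  split; first by move=> n; rewrite subr_eq0.
  by rewrite -[X in _ --> X](subrr x); apply: cvgB => //; exact: cvg_cst.
move/h; apply: cvg_trans; apply: near_eq_cvg; apply: nearW => n /=.
by rewrite /GRing.scale/= mulr1 subrK mulrC.
Qed.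

Lemma has_derivPe F (x l : R) : has_deriv F x l <->
  forall e, 0 < e -> exists2 d, 0 < d &
    forall y, y != x -> `|y - x| < d -> `|F y - F x - l * (y - x)| <= e * `|y - x|.
Proof.
have key y : y != x -> forall e, (`|(F y - F x) / (y - x) - l| <= e) =
    (`|F y - F x - l * (y - x)| <= e * `|y - x|).
  move=> yx e; have yx0 : y - x != 0 by rewrite subr_eq0.
  rewrite -(ler_pM2r (_ : 0 < `|y - x|)) ?normr_gt0// -normrM mulrBl.
  by rewrite divfK.
split=> [[/cvgrPdist_le h] e e0|h].
  have [d /= d0 hd] := h _ e0; exists d => // y yx yd.
  rewrite -key// distrC; apply: hd => //=.
  by rewrite distrC.
split; apply/cvgrPdist_le => e e0; have [d d0 hd] := h _ e0.
exists d => //= y yd yx; rewrite distrC key//; apply: hd => //.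
by rewrite distrC.
Qed.

#[global] Instance within_Rplus_dnbhs_proper (x : R) : Rplus x ->
  ProperFilter (within Rplus x^').
Proof.
rewrite Rplus_ge0 => x0; apply: Build_ProperFilter_ex.
move=> B [d /= d0 hd]; exists (x + d / 2); apply: hd => //=.
- rewrite opprD addNKr normrN gtr0_norm ?divr_gt0//.
  by rewrite ltr_pdivrMr// ltr_pMr// ltr1n.
- by rewrite -subr_eq0 addrAC subrr add0r mulf_neq0// ?gt_eqF.
- by rewrite Rplus_ge0 addr_ge0// divr_ge0// ltW.
Qed.

Lemma is_deriv_Rplus_lim F (x l : R) : 0 <= x -> is_deriv_Rplus F x l ->
  deriv_Rplus F x = l.
Proof.
rewrite -Rplus_ge0 => x0 h.
have PF := within_Rplus_dnbhs_proper x0.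
exact: cvg_lim h.
Qed.

Lemma has_deriv_Rplus F (x l : R) : has_deriv F x l -> is_deriv_Rplus F x l.
Proof.
move=> [h]; apply: cvg_trans h; apply: cvg_app.
exact: cvg_within.
Qed.

Lemma is_deriv_RplusPe F (x l : R) : is_deriv_Rplus F x l <->
  forall e, 0 < e -> exists2 d, 0 < d &
    forall y, 0 <= y -> y != x -> `|y - x| < d ->
    `|F y - F x - l * (y - x)| <= e * `|y - x|.
Proof.
have key y : y != x -> forall e, (`|(F y - F x) / (y - x) - l| <= e) =
    (`|F y - F x - l * (y - x)| <= e * `|y - x|).
  move=> yx e; have yx0 : y - x != 0 by rewrite subr_eq0.
  rewrite -(ler_pM2r (_ : 0 < `|y - x|)) ?normr_gt0// -normrM mulrBl.
  by rewrite divfK.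
split=> [/cvgrPdist_le h e e0|h].
  have [d /= d0 hd] := h _ e0; exists d => // y y0 yx yd.
  rewrite -key// distrC; apply: hd => //=; first by rewrite distrC.
  by rewrite Rplus_ge0.
apply/cvgrPdist_le => e e0; have [d d0 hd] := h _ e0.
exists d => //= y yd yx; rewrite Rplus_ge0 => y0.
by rewrite distrC key//; apply: hd => //; rewrite distrC.
Qed.

Lemma has_deriv_continuous F (F' : R -> R) :
  (forall x, has_deriv F x (F' x)) -> continuous F.
Proof.
move=> h x; apply/differentiable_continuous/derivable1_diffP.
by have /has_derivP[] := h x.
Qed.

Lemma has_deriv_MVT F (F' : R -> R) (x y : R) :
  (forall z, has_deriv F z (F' z)) -> x < y ->
  exists2 c, x < c < y & F y - F x = F' c * (y - x).
Proof.
move=> h xy; have [||c cxy ->] := @MVT R F F' x y xy.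
- by move=> z _; exact/has_derivP.
- by apply: continuous_subspaceT; exact: has_deriv_continuous h.
- by exists c => //; move: cxy; rewrite in_itv.
Qed.

Lemma has_deriv_lip F (F' : R -> R) (M : R) :
  (forall z, has_deriv F z (F' z)) -> (forall z, `|F' z| <= M) ->
  forall x y, `|F y - F x| <= M * `|y - x|.
Proof.
move=> h hM; have lip x y : x < y -> `|F y - F x| <= M * `|y - x|.
  move=> xy; have [c _ ->] := has_deriv_MVT h xy.
  by rewrite normrM ler_wpM2r.
move=> x y; case: (ltgtP x y) => [|yx|->]; first exact: lip.
  by rewrite distrC (distrC y); exact: lip.
by rewrite !subrr normr0 mulr0.
Qed.

Lemma has_deriv_FTC F (F' : R -> R) (a b : R) :
  (forall z, has_deriv F z (F' z)) -> continuous F' -> a <= b ->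
  \int[lebesgue_measure]_(z in `[a, b]) F' z = F b - F a.
Proof.
move=> h cF'; rewrite le_eqVlt => /predU1P[->|ab].
  by rewrite set_itv1 Rintegral_set1 subrr.
have cF := has_deriv_continuous h.
rewrite /Rintegral (@continuous_FTC2 R F' F)//.
- exact: continuous_subspaceT.
- split.
  + by move=> z _; have /has_derivP[] := h z.
  + by apply: cvg_at_right_filter; exact: cF.
  + by apply: cvg_at_left_filter; exact: cF.
- by move=> z _; have /has_derivP[_ <-] := h z; rewrite derive1E.
Qed.

(** The hypotheses on F concern the half-line only: the limit to which this is
    applied is known to be the transition semigroup at nonnegative points, and
    says nothing elsewhere. The mean value theorem bounds the increments of Fn
    by those of its derivatives, which are uniformly close to the continuous
    function G. *)
Lemma has_deriv_limit (Fn Gn : nat -> R -> R) F G (e : nat -> R) :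
  (forall n x, has_deriv (Fn n) x (Gn n x)) ->
  (forall x, 0 <= x -> Fn n x @[n --> \oo] --> F x) ->
  continuous G -> (forall n x, `|Gn n x - G x| <= e n) ->
  e n @[n --> \oo] --> 0 ->
  forall x, 0 <= x -> is_deriv_Rplus F x (G x).
Proof.
move=> hF cF cG he e0 x x0; apply/is_deriv_RplusPe => eps eps0.
have /cvgrPdist_le /(_ _ eps0) [d /= d0 hd] := cG x.
exists d => // y y0 yx yd.
have key n : `|Fn n y - Fn n x - G x * (y - x)| <= (eps + e n) * `|y - x|.
  have [c cd ->] : exists2 c, `|x - c| < d &
      Fn n y - Fn n x = Gn n c * (y - x).
    move: yx; rewrite neq_lt => /orP[xy|xy].
      have [c /andP[c1 c2] hc] := has_deriv_MVT (hF n) xy; exists c; last first.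
        by rewrite -[LHS]opprB hc -mulrN opprB.
      by apply: le_lt_trans yd; rewrite (distrC y) !ger0_norm; lra.
    have [c /andP[c1 c2] hc] := has_deriv_MVT (hF n) xy; exists c => //.
    by apply: le_lt_trans yd; rewrite (distrC x) !ger0_norm; lra.
  rewrite -mulrBl normrM ler_wpM2r//.
  rewrite (_ : _ - _ = (G c - G x) + (Gn n c - G c)); last by ring.
  rewrite (le_trans (ler_normD _ _))// lerD//.
  by rewrite distrC; exact: hd.
have lim1 : `|Fn n y - Fn n x - G x * (y - x)| @[n --> \oo] -->
    `|F y - F x - G x * (y - x)|.
  apply: cvg_norm; apply: cvgB; last exact: cvg_cst.
  by apply: cvgB; exact: cF.
have lim2 : (eps + e n) * `|y - x| @[n --> \oo] --> eps * `|y - x|.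
  rewrite -{2}(addr0 eps); apply: cvgM; last exact: cvg_cst.
  by apply: cvgD => //; exact: cvg_cst.
by apply: (ler_cvg_to lim1 lim2); exact: nearW.
Qed.

Lemma uniform_limit_continuous (Gn : nat -> R -> R) G (e : nat -> R) :
  (forall n, continuous (Gn n)) -> (forall n x, `|Gn n x - G x| <= e n) ->
  e n @[n --> \oo] --> 0 -> continuous G.
Proof.
move=> cG he /cvgrPdist_le e0 x; apply/cvgrPdist_le => eps eps0.
have [N _ /(_ _ (leqnn N))] := e0 _ (divr_gt0 eps0 (ltr0n _ 4)).
rewrite /= sub0r normrN => /(le_trans (ler_norm _)) eN.
have /cvgrPdist_le /(_ _ (divr_gt0 eps0 (ltr0n _ 4))) := cG N x.
apply: filterS => y hy.
have h1 := he N x; have h2 := he N y.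
rewrite (_ : G x - G y = (Gn N x - Gn N y) - (Gn N x - G x) + (Gn N y - G y));
  last by ring.
rewrite (le_trans (ler_normD _ _))//.
have := ler_normB (Gn N x - Gn N y) (Gn N x - G x).
lra.
Qed.

(** Stopping at the origin creates a kink at c only, where the formula would
    need F'(0) = 0. *)
Lemma has_deriv_max F (F' : R -> R) (c x : R) :
  (forall z, has_deriv F z (F' z)) -> x != c ->
  has_deriv (fun y => F (Num.max (y - c) 0)) x
    ((c < x)%R%:R * F' (Num.max (x - c) 0)).
Proof.
move=> h; rewrite neq_lt => /orP[xc|cx]; apply/has_derivPe => e e0.
  exists (c - x); first by rewrite subr_gt0.
  move=> y yx; rewrite ltr_norml => /andP[_ yd].
  rewrite (max_r (_ : x - c <= 0)); last by lra.
  rewrite (max_r (_ : y - c <= 0)); last by lra.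
  by rewrite ltNge (ltW xc)/= !mul0r subrr subr0 normr0 mulr_ge0// ltW.
have /has_derivPe /(_ _ e0) [d d0 hd] := h (x - c).
exists (Num.min d (x - c)); first by rewrite lt_min d0 subr_gt0.
move=> y yx; rewrite lt_min => /andP[yd]; rewrite ltr_norml => /andP[yc _].
rewrite (max_l (_ : 0 <= x - c)); last by lra.
rewrite (max_l (_ : 0 <= y - c)); last by lra.
rewrite cx mul1r; have := hd (y - c).
rewrite (_ : y - c - (x - c) = y - x); last by ring.
by apply => //; rewrite -subr_eq0 (_ : y - c - (x - c) = y - x) ?subr_eq0//; ring.
Qed.

Lemma has_deriv_shift F (F' : R -> R) (z x : R) :
  has_deriv F (x + z) (F' (x + z)) -> has_deriv (fun y => F (y + z)) x (F' (x + z)).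
Proof.
move/has_derivPe => h; apply/has_derivPe => e e0; have [d d0 hd] := h e e0.
exists d => // y yx yd.
have E : y + z - (x + z) = y - x by ring.
rewrite -E; apply: hd; last by rewrite E.
by rewrite -subr_eq0 E subr_eq0.
Qed.

End difference_quotients.

Lemma max0_lip {R : realType} (x y : R) :
  `|Num.max x 0 - Num.max y 0| <= `|x - y|.
Proof.
case: (ltP x 0) => ?; case: (ltP y 0) => ?; case: (ger0P (x - y)) => ?;
  rewrite ?ler_norml; (lra || (apply/andP; split; lra)).
Qed.

(** * Extension of a terminal function to the line *)

Section extension.
Context {R : realType}.
Variable f : R -> R.
Hypothesis f_C1 : bC1_star f.

(** The constant extension of f to the left of the origin is C^1 because
    f'(0) = 0; this spares every later argument a distinction between the origin
    and the other points. *)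
Definition fext (x : R) : R := f (Num.max x 0).
Definition dext (x : R) : R := deriv_Rplus f (Num.max x 0).

Lemma bdm_fext : bdm fext.
Proof.
have [[bf cf _ _ _] _] := f_C1; apply: bBorel_pos; split => //.
by apply: subspace_continuous_measurable_fun => //; exact: measurable_Rplus.
Qed.

Lemma bdm_dext : bdm dext.
Proof.
have [[_ _ _ bf cf] _] := f_C1; apply: bBorel_pos; split => //.
by apply: subspace_continuous_measurable_fun => //; exact: measurable_Rplus.
Qed.

Lemma continuous_dext : continuous dext.
Proof.
have [[_ _ _ _ cf] _] := f_C1 => x.
have /= cx := cf (Num.max x 0).
apply/cvgrPdist_le => e e0.
have : within Rplus (nbhs (Num.max x 0))
    (fun y => `|deriv_Rplus f (Num.max x 0) - deriv_Rplus f y| <= e).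
  move: cx; rewrite /continuous_at /nbhs /= /nbhs_subspace.
  case: ifPn => [_|]; last by rewrite notin_setE; have := Rplus_pos x.
  by move/cvgrPdist_le => /(_ _ e0).
move=> [d /= d0 hd]; exists d => //= y yd; apply: hd => /=; last exact: Rplus_pos.
apply: le_lt_trans yd.
exact: max0_lip.
Qed.

(** At a nonpositive point the increment of the extension is either zero or an
    increment of f from the origin, negligible since f'(0) = 0. *)
Lemma has_deriv_fext x : has_deriv fext x (dext x).
Proof.
have [[_ _ df _ _] d0] := f_C1.
have /is_deriv_RplusPe h := df _ (Rplus_pos x).
apply/has_derivPe => e e0; have [d dp hd] := h _ e0.
case: (ltP 0 x) => x0.
  exists (Num.min d x); first by rewrite lt_min dp x0.
  move=> y yx; rewrite lt_min => /andP[yd]; rewrite ltr_norml => /andP[yc _].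
  rewrite /fext /dext; move: hd.
  rewrite (max_l (ltW x0)) (max_l (_ : 0 <= y)); last by lra.
  by apply => //; lra.
exists d => // y yx yd; rewrite /fext /dext (max_r x0) d0 mul0r subr0.
move: hd; rewrite (max_r x0) d0 => hd.
case: (ltP 0 y) => y0; last first.
  by rewrite ?(max_r y0) subrr normr0 mulr_ge0// ltW.
rewrite ?(max_l (ltW y0)).
have := hd y (ltW y0); rewrite gt_eqF// mul0r !subr0 => hy.
have le1 : `|y| <= `|y - x| by rewrite !ger0_norm; lra.
by rewrite (le_trans (hy _ _))//; [exact: le_lt_trans yd|rewrite ler_wpM2l// ltW].
Qed.

Lemma dext_le0 x : x <= 0 -> dext x = 0.
Proof. by move=> x0; rewrite /dext max_r//; case: f_C1. Qed.

End extension.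

(** * Measurability tested on smooth steps *)

Section test_functions.
Context {R : realType}.

(** No kink is left where the two branches meet with zero slope. *)
Lemma has_deriv_max0 (F F' : R -> R) (c : R) :
  (forall z, has_deriv F z (F' z)) -> F' 0 = 0 ->
  forall x, has_deriv (fun y => F (Num.max (y - c) 0)) x (F' (Num.max (x - c) 0)).
Proof.
move=> h F0 x; have [->|xc] := eqVneq x c; last first.
  have := has_deriv_max h xc; case: (ltP c x) => cx; first by rewrite mul1r.
  by rewrite mul0r (max_r (_ : x - c <= 0)) ?F0// subr_le0.
rewrite subrr maxxx F0; apply/has_derivPe => e e0.
have /has_derivPe /(_ _ e0) [d d0] := h 0; rewrite F0 => hd.
exists d => // y yc yd; rewrite subrr maxxx mul0r subr0.
case: (ltP 0 (y - c)) => yc0; last first.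
  by rewrite subrr normr0 mulr_ge0// ltW.
have := hd (y - c); rewrite mul0r !subr0; apply => //.
by rewrite gt_eqF.
Qed.

Lemma bC1_star_of (F F' : R -> R) (M : R) :
  (forall x, has_deriv F x (F' x)) -> continuous F' -> (forall x, `|F x| <= M) ->
  (forall x, `|F' x| <= M) -> F' 0 = 0 -> bC1_star F.
Proof.
move=> h cF' FM F'M F0.
have E x : Rplus x -> deriv_Rplus F x = F' x.
  by rewrite Rplus_ge0 => x0; apply: is_deriv_Rplus_lim => //; exact: has_deriv_Rplus.
split; last by rewrite E ?Rplus_ge0.
split.
- by exists M => x _.
- by apply: continuous_subspaceT; exact: has_deriv_continuous h.
- by move=> x x0; rewrite E//; exact: has_deriv_Rplus.
- by exists M => x x0; rewrite E.
- apply: (@subspace_eq_continuous _ _ _ F'); last exact: continuous_subspaceT.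
  by move=> x; rewrite inE => x0; rewrite /from_subspace /= E.
Qed.

(** The functions x^2 / (x^2 + e) rise from 0 to 1 with zero slope at the origin,
    so that their shifts stopped at b are admissible test functions in the
    definition of a generalized CDR model; as e decreases to 0 they converge to
    the indicator of the ray ]b, +oo[. *)
Section rational_step.
Variable e : R.
Hypotheses (e_gt0 : 0 < e) (e_le1 : e <= 1).

Definition rstep (x : R) := x ^+ 2 / (x ^+ 2 + e).
Definition drstep (x : R) := 2 * x * e / (x ^+ 2 + e) ^+ 2.

Let den_gt0 (x : R) : 0 < x ^+ 2 + e.
Proof. by rewrite ltr_wpDl// sqr_ge0. Qed.

Lemma has_deriv_rstep x : has_deriv rstep x (drstep x).
Proof.
(* the difference quotient of [rstep] at x simplifies to a continuous function *)
pose q (y : R) := e * (y + x) / ((y ^+ 2 + e) * (x ^+ 2 + e)).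
have cq : continuous q.
  move=> y; apply: cvgM; first by apply: cvgM; [exact: cvg_cst|apply: cvgD; [exact: cvg_id|exact: cvg_cst]].
  apply: cvgV; first by rewrite mulf_neq0// gt_eqF.
  apply: cvgM; last exact: cvg_cst.
  apply: cvgD; last exact: cvg_cst.
  by apply: cvgM; exact: cvg_id.
have -> : drstep x = q x.
  by rewrite /drstep /q; field; rewrite -?expr2 gt_eqF.
split; apply/cvgrPdist_le => eps eps0.
have /cvgrPdist_le /(_ _ eps0) [d d0 hd] := cq x.
exists d => // y yd yx; rewrite /=.
rewrite (_ : (_ - _) / _ = q y); first exact: hd.
rewrite /rstep /q; field; rewrite -?expr2.
by rewrite subr_eq0 yx !gt_eqF.
Qed.

Lemma continuous_drstep : continuous drstep.
Proof.
move=> y; apply: cvgM; first by apply: cvgM; [apply: cvgM; [exact: cvg_cst|exact: cvg_id]|exact: cvg_cst].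
apply: cvgV; first by rewrite expf_neq0// gt_eqF.
by apply: cvgM; (apply: cvgD; [apply: cvgM; exact: cvg_id|exact: cvg_cst]).
Qed.

Lemma rstep_ge0 x : 0 <= rstep x.
Proof. by rewrite /rstep divr_ge0// ?sqr_ge0// ltW. Qed.

Lemma rstep_le1 x : rstep x <= 1.
Proof. by rewrite /rstep ler_pdivrMr// mul1r lerDl ltW. Qed.

Lemma drstep_bound x : `|drstep x| <= 2 / e.
Proof.
have d0 := den_gt0 x.
rewrite /drstep normrM (@ger0_norm _ (_ ^-1)) ?invr_ge0 ?sqr_ge0//.
rewrite ler_pdivrMr ?exprn_gt0// -(ler_pM2r e_gt0).
rewrite (_ : 2 / e * (x ^+ 2 + e) ^+ 2 * e = 2 * (x ^+ 2 + e) ^+ 2); last first.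
  by field; rewrite gt_eqF.
rewrite !normrM (@ger0_norm _ (2 : R))// (@gtr0_norm _ e)//.
have := normr_ge0 x; rewrite -(real_normK (num_real x)).
set y := `|x| => y0.
have y1 : y <= 1 + 2 * y ^+ 2 by nra.
have ey : e * e * y <= e * e * (1 + 2 * y ^+ 2) by rewrite ler_pM2l// mulr_gt0.
have ? : 0 <= y ^+ 2 by rewrite sqr_ge0.
have ? : e * e * y ^+ 2 <= e * y ^+ 2 by rewrite ler_wpM2r// -[leRHS]mulr1 ler_pM2l.
nra.
Qed.

End rational_step.

Definition tstep (b : R) (n : nat) (x : R) : R :=
  rstep (n.+1%:R^-1) (Num.max (x - b) 0).

Let en_gt0 n : 0 < n.+1%:R^-1 :> R. Proof. by rewrite invr_gt0 ltr0n. Qed.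
Let en_le1 n : n.+1%:R^-1 <= 1 :> R.
Proof. by rewrite invf_le1 ?ltr0n// ler1n. Qed.

Definition dtstep (b : R) (n : nat) (x : R) : R :=
  drstep (n.+1%:R^-1) (Num.max (x - b) 0).

Lemma has_deriv_tstep b n x : has_deriv (tstep b n) x (dtstep b n x).
Proof.
have d0 : drstep (n.+1%:R^-1 : R) 0 = 0 by rewrite /drstep mulr0 !mul0r.
exact: (@has_deriv_max0 _ _ b (has_deriv_rstep (en_gt0 n)) d0 x).
Qed.

Lemma dtstep_bound b n x : `|dtstep b n x| <= 2 * n.+1%:R.
Proof. by rewrite -[n.+1%:R in leRHS]invrK; exact: drstep_bound. Qed.

Lemma tstep_norm b n x : `|tstep b n x| <= 1.
Proof.
rewrite ger0_norm; first exact: rstep_le1.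
exact: rstep_ge0.
Qed.

Lemma continuous_tstep b n : continuous (tstep b n).
Proof. exact: (@has_deriv_continuous _ _ (dtstep b n) (has_deriv_tstep b n)). Qed.

Lemma bdm_tstep b n : bdm (tstep b n).
Proof.
split; last by exists 1; exact: tstep_norm.
apply: continuous_measurable_fun; exact: continuous_tstep.
Qed.

Lemma tstep_lip b n x y : `|tstep b n y - tstep b n x| <= 2 * n.+1%:R * `|y - x|.
Proof.
exact: (@has_deriv_lip _ _ (dtstep b n) _ (has_deriv_tstep b n) (dtstep_bound b n)).
Qed.

Lemma bC1_star_tstep b n : 0 <= b -> bC1_star (tstep b n).
Proof.
move=> b0; apply: (@bC1_star_of _ (dtstep b n) (2 * n.+1%:R)).
- exact: has_deriv_tstep.
- move=> x; apply: (@continuous_comp _ _ _ (fun x : R => Num.max (x - b) 0) (drstep _)).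
    apply/cvgrPdist_le => e e0; exists e => //= y yd.
    apply: le_trans (max0_lip _ _) _.
    by rewrite (_ : x - b - (y - b) = x - y) ?ltW//; ring.
  exact: continuous_drstep.
- move=> x; apply: le_trans (tstep_norm _ _ _) _.
  have : (1 : R) <= n.+1%:R by rewrite ler1n.
  lra.
- exact: dtstep_bound.
- by rewrite /dtstep max_r ?sub0r ?oppr_le0// /drstep mulr0 !mul0r.
Qed.

Lemma tstep_cvg b x : tstep b n x @[n --> \oo] --> ((b < x)%R%:R : R).
Proof.
rewrite /tstep /rstep; case: (ltP b x) => bx; last first.
  rewrite max_r ?subr_le0//.
  by under eq_fun do rewrite expr2 mulr0 mul0r; exact: cvg_cst.
rewrite max_l ?subr_ge0 ?(ltW bx)//; set w := (x - b) ^+ 2.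
have w0 : w != 0 by rewrite /w expf_neq0// subr_eq0 gt_eqF.
rewrite -[X in _ --> X](divff w0); apply: cvgM; first exact: cvg_cst.
apply: cvgV => //; rewrite -[X in _ --> X]addr0; apply: cvgD; first exact: cvg_cst.
exact: cvg_harmonic.
Qed.

(** Measurability of the integrals of the smooth steps passes to the measures of
    the rays by dominated convergence; rays that start at a negative level carry
    the full mass. *)
Lemma meas_family_tstep {d} {X : measurableType d} (l : X -> borel_prob R) :
  (forall x, on_Rplus (l x)) ->
  (forall b n, 0 <= b -> measurable_fun setT (fun x => \int[l x]_y tstep b n y)) ->
  meas_family l.
Proof.
move=> lR ml; apply: meas_family_rays => b.
have mb : measurable (`]b, +oo[%classic : set (measurableTypeR R)).
  exact: measurable_itv.
case: (ltP b 0) => b0.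
  rewrite (_ : (fun x => _) = cst 1%E); first exact: measurable_cst.
  apply/funext => x; apply/eqP; rewrite eq_le probability_le1//=.
  rewrite -(lR x); apply: le_measure; rewrite ?inE//; first exact: measurable_Rplus.
  by move=> y; rewrite Rplus_ge0 /= in_itv/= andbT; exact: lt_le_trans.
have E x : l x `]b, +oo[%classic = (\int[l x]_y (b < y)%R%:R)%:E.
  rewrite -[LHS]fineK ?fin_num_measure//; congr EFin.
  rewrite -[in LHS](setIT `]b, +oo[%classic) -integral_indic//.
  rewrite /Rintegral; congr fine; apply: eq_integral => y _.
  congr EFin; rewrite indicE; congr (_ : bool)%:R.
  by apply/idP/idP; rewrite inE /= in_itv/= andbT.
under eq_fun do rewrite E.
apply/measurable_EFinP.
apply: (@measurable_fun_cvg _ _ _ _ (fun n x => \int[l x]_y tstep b n y)) => //.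
  by move=> n; exact: ml.
move=> x _; apply: (@bdm_cvg_int _ _ _ _ _ _ 1).
- by move=> n; case: (bdm_tstep b n).
- by apply: measurable_bool; apply: measurable_fun_ltr.
- by move=> n y; exact: tstep_norm.
- by apply: aeW => y; exact: tstep_cvg.
Qed.

End test_functions.

Section measurable_paths.
Context {R : realType}.

(** Differentiability makes the function continuous, hence measurable. *)
Lemma is_deriv_Rplus_measurable (h : R -> R) :
  (forall t, 0 <= t -> exists l, is_deriv_Rplus h t l) ->
  measurable_fun setT (fun t : R => h (Num.max t 0)).
Proof.
move=> hd; apply: continuous_measurable_fun => t.
have t0 : 0 <= Num.max t 0 by rewrite le_max lexx orbT.
have [l /is_deriv_RplusPe /(_ 1 ltr01) [d d0 hl]] := hd _ t0.
apply/cvgrPdist_le => e e0.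
pose C := `|l| + 1.
have C0 : 0 < C by rewrite /C ltr_wpDl.
exists (Num.min d (e / C)); first by rewrite /= lt_min d0 divr_gt0.
move=> s /=; rewrite lt_min => /andP[sd se].
have lip := max0_lip s t; rewrite (distrC s t) in lip.
have s0 : 0 <= Num.max s 0 by rewrite le_max lexx orbT.
have [->|st] := eqVneq (Num.max s 0) (Num.max t 0).
  by rewrite subrr normr0 ltW.
have := hl _ s0 st (le_lt_trans lip sd).
set y := Num.max s 0 - Num.max t 0 in lip *; rewrite mul1r => hy.
rewrite distrC (_ : _ - _ = (h (Num.max s 0) - h (Num.max t 0) - l * y) + l * y);
  last by ring.
rewrite (le_trans (ler_normD _ _))// normrM.
move: se; rewrite ltr_pdivlMr// /C => se.
have := ler_wpM2l (normr_ge0 l) lip.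
have := normr_ge0 y.
nra.
Qed.

(** The constant C may depend on T only, which is what an exponential weight
    leaves in [weak_path_measurable]. *)
Lemma locally_lipschitz_measurable (G : R -> R) (r : R) :
  (forall T, exists C, forall t t', r <= t -> t <= t' -> t' <= T ->
    `|G t' - G t| <= C * (t' - t)) ->
  measurable_fun setT (fun t : R => G (Num.max t r)).
Proof.
move=> hG; apply: continuous_measurable_fun => t.
have [C hC] := hG (Num.max t r + 1).
apply/cvgrPdist_le => e e0.
pose D := `|C| + 1.
have D0 : 0 < D by rewrite /D ltr_wpDl.
exists (Num.min 1 (e / D)); first by rewrite /= lt_min ltr01 divr_gt0.
move=> s /=; rewrite lt_min => /andP[sd]; rewrite ltr_pdivlMr// => se.
have lip : `|Num.max s r - Num.max t r| <= `|t - s|.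
  have maxE u : Num.max u r = Num.max (u - r) 0 + r.
    by rewrite addr_maxl subrK add0r.
  rewrite !maxE opprD addrACA subrr addr0 distrC.
  by apply: le_trans (max0_lip _ _) _; rewrite opprB addrA subrK.
have ge1 : r <= Num.max s r by rewrite le_max lexx orbT.
have ge2 : r <= Num.max t r by rewrite le_max lexx orbT.
have leC (u : R) : 0 <= u -> C * u <= `|C| * u by move=> u0; rewrite ler_wpM2r// ler_norm.
case: (leP (Num.max s r) (Num.max t r)) => st.
  rewrite (le_trans (hC _ _ ge1 st _)) ?lerDl//.
  move: lip; rewrite distrC ger0_norm ?subr_ge0// => lip.
  apply: le_trans (leC _ _) _; first by rewrite subr_ge0.
  rewrite (le_trans _ (ltW se))// mulrC /D ler_pM ?subr_ge0//.
  by rewrite lerDl.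
move: lip; rewrite ger0_norm ?subr_ge0 ?(ltW st)// => lip.
rewrite distrC (le_trans (hC _ _ ge2 (ltW st) _))//; first by lra.
apply: le_trans (leC _ _) _; first by rewrite subr_ge0 ltW.
rewrite (le_trans _ (ltW se))// mulrC /D ler_pM ?subr_ge0 ?(ltW st)//.
by rewrite lerDl.
Qed.

End measurable_paths.

(** * The fundamental theorem of calculus along a stopped drift *)

Lemma integrable_setU d (T : measurableType d) (R : realType)
    (m : {measure set T -> \bar R}) (A B : set T) (f : T -> \bar R) :
  measurable A -> measurable B -> [disjoint A & B] ->
  m.-integrable A f -> m.-integrable B f -> m.-integrable (A `|` B) f.
Proof.
move=> mA mB AB /integrableP[mfA iA] /integrableP[mfB iB].
have mf : measurable_fun (A `|` B) f by apply/measurable_funU.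
have maf : measurable_fun (A `|` B) (fun x => `|f x|%E).
  by apply: (measurableT_comp (f := abse)).
apply/integrableP; split; first exact: mf.
rewrite (ge0_integral_setU m mA mB maf)//.
exact: lte_add_pinfty.
Qed.

Section ftc.
Context {R : realType}.
Notation leb := (@lebesgue_measure R).

Lemma continuous_itv_integrable (h : R -> R) (a b : R) : continuous h ->
  leb.-integrable `[a, b] (EFin \o h).
Proof.
move=> ch; apply: continuous_compact_integrable; first exact: segment_compact.
exact: continuous_subspaceT.
Qed.

Lemma expR_has_deriv (al c x : R) :
  has_deriv (fun s => expR (al * (s - c))) x (al * expR (al * (x - c))).
Proof.
apply/has_derivP.
have h1 : is_derive x 1 (fun s : R => al * (s - c)) al.
  have := @is_deriveZ R R R (fun s => s - c) al x 1 1 _.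
  rewrite /GRing.scale/= mulr1; apply.
  have := @is_deriveB R R R id (fun=> c) x 1 1 0 _ _.
  by rewrite subr0; apply.
rewrite mulrC; apply: (@is_derive1_comp R expR (fun s => al * (s - c))).
Qed.

Lemma continuous_expR_aff (al c : R) : continuous (fun s : R => expR (al * (s - c))).
Proof. exact: has_deriv_continuous (expR_has_deriv al c). Qed.

Lemma has_derivM (F F' G G' : R -> R) x :
  has_deriv F x (F' x) -> has_deriv G x (G' x) ->
  has_deriv (fun y => F y * G y) x (F x * G' x + F' x * G x).
Proof.
move=> /has_derivP hF /has_derivP hG; apply/has_derivP.
have := @is_deriveM R R F G x 1 _ _ hF hG.
by rewrite /GRing.scale/= (mulrC (G x)).
Qed.

Lemma int_exp (al s T : R) : 0 <= T ->
  \int[leb]_(v in `[s, s + T]) (al * expR (al * (s - v))) = 1 - expR (- (al * T)).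
Proof.
move=> T0.
have h z : has_deriv (fun v => - expR (- al * (v - s))) z (al * expR (al * (s - z))).
  have := expR_has_deriv (- al) s z => /has_derivP /(@is_deriveN R R R _ z 1 _).
  rewrite mulNr opprK (_ : - al * (z - s) = al * (s - z)); last by ring.
  by move=> ?; apply/has_derivP.
rewrite (has_deriv_FTC h); last 2 first.
- rewrite (_ : (fun v => _) = fun v => al * expR (- al * (v - s))).
    by move=> z; apply: cvgM; [exact: cvg_cst|exact: continuous_expR_aff].
  by apply/funext => v; congr (_ * expR _); ring.
- by rewrite lerDl.
by rewrite subrr mulr0 expR0 (addrC s) addrK mulNr addrC opprK.
Qed.

(** The integrand is the derivative in s of exp(al (s - v)) H((x - (v - s))_+),
    except at s = v - x, where the path that descends from x at unit speed
    reaches the origin. That function is continuous, so it suffices to add the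
    two increments before and after the kink. *)
Lemma kink_FTC (H H' : R -> R) (al r v x : R) :
  (forall z, has_deriv H z (H' z)) -> continuous H' -> r <= v -> 0 <= x ->
  \int[leb]_(s in `[r, v]) (expR (al * (s - v)) *
    (al * H (Num.max (x - (v - s)) 0) +
     (v - s < x)%R%:R * H' (Num.max (x - (v - s)) 0))) =
  H x - expR (al * (r - v)) * H (Num.max (x - (v - r)) 0).
Proof.
move=> dH cH' rv x0.
pose I s := expR (al * (s - v)) * (al * H (Num.max (x - (v - s)) 0) +
  (v - s < x)%R%:R * H' (Num.max (x - (v - s)) 0)).
rewrite -[LHS]/(\int[leb]_(s in `[r, v]) I s).
have cH := has_deriv_continuous dH.
pose b := Num.max r (v - x).
have rb : r <= b by rewrite le_max lexx.
have bv : b <= v by rewrite ge_max rv lerBlDr lerDl.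
have vxb : v - x <= b by rewrite le_max lexx orbT.
have mbv : measurable (`]b, v]%classic : set (measurableTypeR R)).
  exact: measurable_itv.
have mrb : measurable (`[r, b]%classic : set (measurableTypeR R)).
  exact: measurable_itv.
(* after b the path has not reached the origin: I is the derivative of K *)
pose K s := expR (al * (s - v)) * H (s + (x - v)).
pose K' s := expR (al * (s - v)) * H' (s + (x - v)) +
  al * expR (al * (s - v)) * H (s + (x - v)).
have dK s : has_deriv K s (K' s).
  exact: (has_derivM (F' := fun s => al * expR (al * (s - v)))
    (G' := fun s => H' (s + (x - v))) (expR_has_deriv al v s)
    (has_deriv_shift (dH (s + (x - v))))).
have cs : continuous (fun s : R => s + (x - v)).
  by move=> s; apply: cvgD; [exact: cvg_id|exact: cvg_cst].
have cK' : continuous K'.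
  move=> s; apply: cvgD; apply: cvgM.
  - exact: continuous_expR_aff.
  - by apply: (continuous_comp (f := fun s : R => s + (x - v))); [exact: cs|exact: cH'].
  - by apply: cvgM; [exact: cvg_cst|exact: continuous_expR_aff].
  - by apply: (continuous_comp (f := fun s : R => s + (x - v))); [exact: cs|exact: cH].
have IK' s : b < s -> I s = K' s.
  move=> bs; have xs : v - s < x by have := le_lt_trans vxb bs; lra.
  rewrite /I /K' xs mul1r max_l; last by rewrite subr_ge0 ltW.
  by rewrite (_ : x - (v - s) = s + (x - v)); ring.
have intK' c d : leb.-integrable `[c, d] (EFin \o K').
  exact: continuous_itv_integrable.
have after : leb.-integrable `]b, v] (EFin \o I) /\
    \int[leb]_(s in `]b, v]) I s = H x - expR (al * (b - v)) * H (b + (x - v)).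
  have intK : leb.-integrable `]b, v] (EFin \o K').
    by apply: integrableS (intK' b v) => //; exact: subset_itv_oc_cc.
  split.
    apply: (eq_integrable mbv (EFin \o K') (EFin \o I) _ intK).
    by move=> s; rewrite inE /= in_itv/= => /andP[bs _]; rewrite /= IK'.
  rewrite (@eq_Rintegral _ _ _ leb _ K'); last first.
    by move=> s; rewrite inE /= in_itv/= => /andP[bs _]; rewrite IK'.
  rewrite Rintegral_itv_obnd_cbnd//.
  rewrite (has_deriv_FTC dK cK' bv) /K subrr mulr0 expR0 mul1r.
  by rewrite (_ : v + (x - v) = x)//; ring.
(* before b, if r < b, the path is at the origin: I is the derivative of Q *)
pose Q s := H 0 * expR (al * (s - v)).
pose Q' s := H 0 * (al * expR (al * (s - v))).
have dQ s : has_deriv Q s (Q' s).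
  have /has_derivP := expR_has_deriv al v s.
  by move/(@is_deriveZ R R R _ (H 0) s 1) => ?; apply/has_derivP.
have cQ' : continuous Q'.
  by move=> s; apply: cvgM; [exact: cvg_cst|apply: cvgM; [exact: cvg_cst|exact: continuous_expR_aff]].
have IQ' s : r < b -> s <= b -> I s = Q' s.
  move=> rb' sb; have bE : b = v - x.
    by move: rb'; rewrite /b; case: (leP r (v - x)) => //; rewrite ltxx.
  have xs : x <= v - s by move: sb; rewrite bE; lra.
  rewrite /I /Q' ltNge xs mul0r addr0 max_r; last by rewrite subr_le0.
  by ring.
have before : leb.-integrable `[r, b] (EFin \o I) /\
    \int[leb]_(s in `[r, b]) I s =
    expR (al * (b - v)) * H (b + (x - v)) -
    expR (al * (r - v)) * H (Num.max (x - (v - r)) 0).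
  move: rb; rewrite le_eqVlt => /predU1P[rb|rb].
    rewrite -rb set_itv1; split.
      apply/integrableP; split; first exact: measurable_fun_set1.
      by rewrite integral_set1.
    have rx : v - x <= r by rewrite rb.
    rewrite Rintegral_set1 max_l; last by lra.
    by rewrite (_ : x - (v - r) = r + (x - v)) ?subrr//; ring.
  have bE : b = v - x.
    by move: rb; rewrite /b; case: (leP r (v - x)) => //; rewrite ltxx.
  have intQ : leb.-integrable `[r, b] (EFin \o Q') by exact: continuous_itv_integrable.
  split.
    apply: (eq_integrable mrb (EFin \o Q') (EFin \o I) _ intQ).
    by move=> s; rewrite inE /= in_itv/= => /andP[_ sb]; rewrite /= IQ'.
  rewrite (@eq_Rintegral _ _ _ leb _ Q'); last first.
    by move=> s; rewrite inE /= in_itv/= => /andP[_ sb]; rewrite IQ'.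
  rewrite (has_deriv_FTC dQ cQ' (ltW rb)) /Q max_r; last by move: rb; rewrite bE; lra.
  rewrite (_ : b + (x - v) = 0); last by rewrite bE; ring.
  by rewrite [in RHS]mulrC; congr (_ - _); rewrite mulrC.
have sp : `[r, v]%classic = `[r, b] `|` `]b, v] :> set R.
  apply/seteqP; split => s /=; rewrite !in_itv/=.
    by move=> /andP[rs sv]; case: (leP s b) => sb; [left|right]; rewrite ?rs ?sv.
  move=> [/andP[-> sb]|/andP[bs ->]]; first by rewrite (le_trans sb).
  by rewrite andbT (le_trans rb)// ltW.
have disj : [disjoint (`[r, b]%classic : set (measurableTypeR R)) & `]b, v]%classic].
  apply/disj_set2P; apply/seteqP; split => // s [/=].
  by rewrite !in_itv/= => /andP[_ sb] /andP[bs _]; move: (le_lt_trans sb bs); rewrite ltxx.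
have intI : leb.-integrable (`[r, b] `|` `]b, v]) (EFin \o I).
  exact: (integrable_setU mrb mbv disj before.1 after.1).
rewrite sp (Rintegral_setU mrb mbv intI disj) before.2 after.2; ring.
Qed.

End ftc.

(** * Finite time horizon *)

Section time_measure.
Context {R : realType}.
Notation leb := (@lebesgue_measure R).

Lemma leb_itv_lty (T : R) : (leb (`[0%R, T]%classic : set (measurableTypeR R)) < +oo)%E.
Proof. by rewrite lebesgue_measure_itv/=; case: ifP => // _; rewrite -EFinB ltry. Qed.

Lemma measurable_itv0 (T : R) : measurable (`[0, T]%classic : set (measurableTypeR R)).
Proof. exact: measurable_itv. Qed.

(** Integrals over time become integrals of bounded functions against a finite
    measure on the whole line, the bounds of integration being indicators in the
    integrand; Fubini can then be used when the bounds depend on one another. *)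
Definition tmeas (T : R) : {finite_measure set (measurableTypeR R) -> \bar R} :=
  mfrestr (measurable_itv0 T) (leb_itv_lty T).

Lemma tmeas_sub (T : R) (A : set (measurableTypeR R)) :
  A `<=` `[0, T]%classic -> tmeas T A = leb A.
Proof. by move=> AT; rewrite /tmeas /= /mfrestr /mrestr setIidl. Qed.

Lemma tmeas_int (T r s : R) (g : R -> R) : 0 <= r -> s <= T ->
  \int[leb]_(v in `[r, s]) g v =
  \int[tmeas T]_v (((r <= v) && (v <= s))%R%:R * g v).
Proof.
move=> r0 sT.
have sub : `[r, s]%classic `<=` `[0, T]%classic .
  move=> v /=; rewrite !in_itv/= => /andP[rv vs].
  by rewrite (le_trans r0)//= (le_trans vs).
transitivity (\int[tmeas T]_(v in (`[r, s]%classic : set (measurableTypeR R))) g v).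
  rewrite /Rintegral; congr fine; apply: eq_measure_integral => A mA As.
  by apply/esym/tmeas_sub; exact: subset_trans sub.
rewrite Rintegral_mkcond; apply: eq_Rintegral => v _.
rewrite patchE; case: ifPn; first by rewrite inE /= in_itv/= => ->; rewrite mul1r.
by rewrite notin_setE /= in_itv/= => /negP/negbTE ->; rewrite mul0r.
Qed.

Lemma tmeas_ae_neq (T c : R) : {ae tmeas T, forall v : R, v != c}.
Proof.
exists [set c]; split.
- exact: measurable_set1.
- apply/eqP; rewrite -measure_le0 /= /mfrestr /mrestr.
  have : (leb (([set c] : set (measurableTypeR R)) `&` `[0%R, T]%classic) <=
    leb ([set c] : set R))%E.
    apply: le_measure; rewrite ?inE//; first exact: measurableI.
  by rewrite lebesgue_measure_set1.
- by move=> v /=; move/negP; rewrite negbK => /eqP.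
Qed.

End time_measure.

(** * Integrals depending on a parameter *)

Section under_the_integral.
Context {d} {Y : measurableType d} {R : realType}.
Variable m : {finite_measure set Y -> \bar R}.

(** Almost everywhere differentiability of the integrand is enough, because the
    kinks are reached at a single time for each starting point. *)
Lemma int_has_deriv (F : R -> Y -> R) (F' : Y -> R) (c M : R) :
  (forall x, bdm (F x)) -> measurable_fun setT F' ->
  (forall x y, `|F x y - F c y| <= M * `|x - c|) ->
  {ae m, forall y, has_deriv (F ^~ y) c (F' y)} ->
  has_deriv (fun x => \int[m]_y F x y) c (\int[m]_y F' y).
Proof.
move=> bF mF' lipF dF; split.
have E x : (\int[m]_y F x y - \int[m]_y F c y) / (x - c) =
    \int[m]_y ((x - c)^-1 * (F x y - F c y)).
  rewrite (bdm_intZl m (x - c)^-1 (bdmB (bF x) (bF c))).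
  by rewrite (bdm_intB m (bF x) (bF c)) [in RHS]mulrC.
under eq_fun do rewrite E.
apply: (@bdm_dnbhs_int _ _ _ _ _ _ _ M) => //.
- by move=> x; case: (bdmM (bdm_cst (x - c)^-1) (bdmB (bF x) (bF c))).
- move=> x y xc; rewrite normrM normfV mulrC ler_pdivrMr//.
  by rewrite normr_gt0 subr_eq0.
- apply: filterS dF => y [dFy]; apply: cvg_trans dFy.
  by apply: near_eq_cvg; apply: nearW => x; rewrite mulrC.
Qed.

Lemma int_continuous_at (F : R -> Y -> R) (c M : R) :
  (forall x, measurable_fun setT (F x)) -> (forall x y, `|F x y| <= M) ->
  {ae m, forall y, {for c, continuous (F ^~ y)}} ->
  {for c, continuous (fun x => \int[m]_y F x y)}.
Proof.
move=> mF FM cF; apply/continuous_withinNx.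
apply: (@bdm_dnbhs_int _ _ _ _ _ _ _ M) => //.
by apply: filterS cF => y /continuous_withinNx.
Qed.

End under_the_integral.

Definition bdm2 (R : realType) (U : R -> R -> R) := bdm (fun z : R * R => U z.1 z.2).

Section bdm2_facts.
Context {R : realType}.
Implicit Types U : R -> R -> R.

Lemma bdm2_row U v : bdm2 U -> bdm (U v).
Proof.
move=> bU; exact: (bdm_comp (g := fun z => U z.1 z.2) (phi := fun y => (v, y))
  (pair1_measurable v) bU).
Qed.

Lemma bdm2_comp U d (X : measurableType d) (f g : X -> R) : bdm2 U ->
  measurable_fun setT f -> measurable_fun setT g -> bdm (fun x => U (f x) (g x)).
Proof.
move=> bU mf mg.
exact: (bdm_comp (g := fun z => U z.1 z.2) (phi := fun x => (f x, g x))
  (measurable_fun_pair mf mg) bU).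
Qed.

End bdm2_facts.

(** * Picard iteration of the first-jump equation

    Between its jumps the process descends at unit speed and stops at the origin;
    it jumps at rate a, at time v by an amount of law [sig v]. Decomposing at the
    first jump after s leads to the map [picard false]. *)

Section picard.
Context {R : realType}.
Variables (a T : R) (sig : R -> borel_prob R).
Hypotheses (a_ge0 : 0 <= a) (T_ge0 : 0 <= T) (msig : meas_family sig).
Implicit Types (U W G : R -> R -> R) (j : bool).
Notation L := (tmeas T).

(** Mean of U(v, .) just after a jump from y at time v. *)
Definition after_jump U (v y : R) : R := \int[sig v]_z U v (y + z).

(** Density of the first jump after s at time v. When j is true, only paths that
    have not reached the origin before v count: the process is killed there. The
    maximum with 0 confines v to [0, T], the support of the time measure, also
    when s < 0. *)
Definition weight j (s x v : R) : R :=
  ((Num.max s 0 <= v <= T) && (j ==> (v - s < x)))%R%:R * (a * expR (a * (s - v))).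

(** [G s x] stands for the contribution of the paths without a jump before T. *)
Definition picard j G U (s x : R) : R :=
  G s x + \int[L]_v (weight j s x v * after_jump U v (Num.max (x - (v - s)) 0)).

Let c := 1 - expR (- (a * T)).

Lemma bdm2_after_jump U : bdm2 U -> bdm2 (after_jump U).
Proof.
move=> bU.
apply: (bdm_family_int (l := fun p : R * R => sig p.1)
  (g := fun (p : R * R) z => U p.1 (p.2 + z))).
  by move=> A mA; apply: (measurableT_comp (msig mA)); exact: measurable_fst.
apply: (bdm2_comp (f := fun z : (R * R) * R => z.1.1)
  (g := fun z : (R * R) * R => z.1.2 + z.2) bU).
- exact: measurableT_comp measurable_fst measurable_fst.
- apply: measurable_funD; last exact: measurable_snd.
  exact: measurableT_comp measurable_snd measurable_fst.
Qed.

Lemma after_jump_row U (v y : R) : bdm2 U -> bdm (fun z : R => U v (y + z)).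
Proof.
move=> bU; apply: (bdm2_comp (f := fun=> v) (g := fun z => y + z) bU) => //.
exact: measurable_funD.
Qed.

Lemma after_jump_norm U (M : R) v y : bdm2 U -> (forall z, `|U v z| <= M) -> `|after_jump U v y| <= M.
Proof.
by move=> bU UM; apply: prob_int_norm_le => //; exact: after_jump_row.
Qed.

Lemma after_jumpB U W v y : bdm2 U -> bdm2 W ->
  after_jump (fun s x => U s x - W s x) v y = after_jump U v y - after_jump W v y.
Proof. by move=> bU bW; rewrite /after_jump bdm_intB//; exact: after_jump_row. Qed.

Lemma weight_ge0 j s x v : 0 <= weight j s x v.
Proof. by rewrite /weight !mulr_ge0// expR_ge0. Qed.

Lemma weight_norm j s x v : `|weight j s x v| <= a.
Proof.
rewrite ger0_norm ?weight_ge0// /weight.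
case: (boolP (_ && _)) => [/andP[/andP[sv _] _]|_]; last by rewrite mul0r.
rewrite mul1r -[leRHS]mulr1 ler_wpM2l// -expR0 ler_expR.
move: sv; rewrite ge_max => /andP[sv _].
by rewrite mulr_ge0_le0// subr_le0.
Qed.

Lemma bdm_weight j :
  bdm (fun z : (R * R) * R => weight j z.1.1 z.1.2 z.2).
Proof.
have m1 : measurable_fun setT (fun z : (R * R) * R => z.1.1).
  exact: measurableT_comp measurable_fst measurable_fst.
have m2 : measurable_fun setT (fun z : (R * R) * R => z.1.2).
  exact: measurableT_comp measurable_snd measurable_fst.
have m3 : measurable_fun setT (fun z : (R * R) * R => z.2).
  exact: measurable_snd.
split; last by exists a => z; exact: weight_norm.
apply: measurable_funM.
- apply: measurable_bool; apply: measurable_and.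
    apply: measurable_and; apply: measurable_fun_ler => //.
    exact: measurable_maxr.
  case: j => /=; last exact: measurable_cst.
  by apply: measurable_fun_ltr => //; exact: measurable_funB.
- apply: measurable_funM => //; apply: measurableT_comp => //.
  by apply: measurable_funM => //; exact: measurable_funB.
Qed.

Lemma bdm_integrand j U : bdm2 U ->
  bdm (fun z : (R * R) * R => weight j z.1.1 z.1.2 z.2 *
    after_jump U z.2 (Num.max (z.1.2 - (z.2 - z.1.1)) 0)).
Proof.
move=> bU; apply: bdmM; first exact: bdm_weight.
apply: (bdm2_comp (f := fun z : (R * R) * R => z.2)
  (g := fun z : (R * R) * R => Num.max (z.1.2 - (z.2 - z.1.1)) 0) (bdm2_after_jump bU)).
  exact: measurable_snd.
apply: measurable_maxr => //; apply: measurable_funB.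
  exact: measurableT_comp measurable_snd measurable_fst.
apply: measurable_funB; first exact: measurable_snd.
exact: measurableT_comp measurable_fst measurable_fst.
Qed.

Lemma bdm_integrand_row j U s x : bdm2 U ->
  bdm (fun v => weight j s x v * after_jump U v (Num.max (x - (v - s)) 0)).
Proof.
move=> bU; apply: (bdm_comp (phi := fun v => ((s, x), v)) _ (bdm_integrand j bU)).
exact: pair1_measurable.
Qed.

Lemma bdm_weight_row j s x : bdm (weight j s x).
Proof.
apply: (bdm_comp (phi := fun v => ((s, x), v)) _ (bdm_weight j)).
exact: pair1_measurable.
Qed.

Lemma bdm2_picard j G U : bdm2 G -> bdm2 U -> bdm2 (picard j G U).
Proof.
move=> bG bU; apply: bdmD => //.
exact: (bdm_int_param (g := fun p v => weight j p.1 p.2 v *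
  after_jump U v (Num.max (p.2 - (v - p.1)) 0)) L (bdm_integrand j bU)).
Qed.

Lemma contraction_rate : 0 <= c < 1.
Proof.
apply/andP; split; last by rewrite /c gtrBl expR_gt0.
by rewrite subr_ge0 -expR0 ler_expR oppr_le0 mulr_ge0.
Qed.

(** The time of the next jump is exponential with rate a, so the total weight on
    [s, T] is the probability of a jump before T. *)
Lemma weight_int j s x : \int[L]_v weight j s x v <= c.
Proof.
pose s' := Num.max s 0.
have s'0 : 0 <= s' by rewrite le_max lexx orbT.
have ss' : s <= s' by rewrite le_max lexx.
pose w v : R := (s' <= v <= T)%R%:R * (a * expR (a * (s' - v))).
have wE : w = weight false s' x.
  by apply/funext => v; rewrite /w /weight /= andbT (max_l s'0).
apply: (@le_trans _ _ (\int[L]_v w v)).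
  apply: bdm_le; [exact: bdm_weight_row|rewrite wE; exact: bdm_weight_row|].
  move=> v; rewrite /weight /w; apply: ler_pM => //.
  - by rewrite mulr_ge0// expR_ge0.
  - by rewrite /s'; case: (_ <= v <= T) => //=; case: (_ ==> _).
  - by rewrite ler_wpM2l// ler_expR ler_wpM2l// lerB.
rewrite /w -tmeas_int//.
have [sT|Ts] := leP s' T; last first.
  rewrite set_itv_ge; last by rewrite bnd_simp -ltNge.
  rewrite Rintegral_set0.
  by case/andP: contraction_rate.
have := @int_exp R a s' (T - s').
rewrite [X in `[s', X]]addrC subrK subr_ge0 => ->//.
by rewrite /c lerB// ler_expR lerN2 ler_wpM2l// gerBl.
Qed.

(** [picard j G] is a contraction for the uniform norm; c < 1 on any finite
    horizon, whatever the size of a. *)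
Lemma picard_lip j G U W (M : R) s x : bdm2 U -> bdm2 W ->
  (forall v y, `|U v y - W v y| <= M) ->
  `|picard j G U s x - picard j G W s x| <= c * M.
Proof.
move=> bU bW UW; rewrite /picard opprD addrACA subrr add0r.
rewrite -bdm_intB; [|exact: bdm_integrand_row..].
apply: (@le_trans _ _ (\int[L]_v (M * weight j s x v))).
  apply: bdm_norm_le.
  - by apply: bdmB; exact: bdm_integrand_row.
  - by apply: bdmM; [exact: bdm_cst|exact: bdm_weight_row].
  - move=> v; rewrite -mulrBr normrM (ger0_norm (weight_ge0 _ _ _ _)) mulrC.
    rewrite ler_wpM2r ?weight_ge0// -after_jumpB//.
    by apply: after_jump_norm => //; exact: bdmB.
have M0 : 0 <= M := le_trans (normr_ge0 _) (UW 0 0).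
rewrite (bdm_intZl L M (bdm_weight_row j s x)) [leRHS]mulrC.
by rewrite ler_wpM2l// weight_int.
Qed.

Lemma picard_bound j G U (B M : R) s x : bdm2 U ->
  (forall v y, `|G v y| <= B) -> (forall v y, `|U v y| <= M) ->
  `|picard j G U s x| <= B + c * M.
Proof.
move=> bU GB UM.
have -> : picard j G U s x = G s x + (picard j G U s x - picard j G (fun _ _ => 0) s x).
  rewrite {3}/picard /after_jump; under eq_Rintegral do rewrite Rintegral_cst// mul0r mulr0.
  by rewrite Rintegral_cst// mul0r addr0 addrC subrK.
apply: (le_trans (ler_normD _ _)); apply: lerD => //.
apply: picard_lip => //; first exact: bdm_cst.
by move=> v y; rewrite subr0.
Qed.

Definition iterate j G n : R -> R -> R := iter n (picard j G) G.

Lemma bdm2_iterate j G n : bdm2 G -> bdm2 (iterate j G n).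
Proof. by move=> bG; elim: n => //= n IH; exact: bdm2_picard. Qed.

Lemma iterate_bound j G (B : R) n s x : bdm2 G -> (forall v y, `|G v y| <= B) ->
  `|iterate j G n s x| <= B / (1 - c).
Proof.
move=> bG GB; have /andP[c0 c1] := contraction_rate.
have d0 : 0 < 1 - c by rewrite subr_gt0.
have B0 : 0 <= B := le_trans (normr_ge0 _) (GB 0 0).
elim: n s x => [|n IH] s x.
  by rewrite (le_trans (GB _ _))// ler_pdivlMr// ler_piMr// gerBl.
apply: (le_trans (picard_bound j s x (bdm2_iterate j n bG) GB IH)).
by rewrite le_eqVlt; apply/orP; left; apply/eqP; field; rewrite gt_eqF.
Qed.

Lemma iterate_cauchy j G (B : R) n s x : bdm2 G -> (forall v y, `|G v y| <= B) ->
  `|iterate j G n.+1 s x - iterate j G n s x| <= 2 * (B / (1 - c)) * c ^+ n.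
Proof.
move=> bG GB; elim: n s x => [|n IH] s x.
  rewrite expr0 mulr1 (le_trans (ler_normB _ _))// mulr_natl mulr2n lerD//.
    exact: (iterate_bound j 1).
  exact: (iterate_bound j 0).
rewrite exprS mulrCA.
by apply: (picard_lip j G s x (bdm2_iterate j n.+1 bG) (bdm2_iterate j n bG)).
Qed.

Lemma after_jump_has_deriv U W v y : bdm2 U -> bdm2 W ->
  (forall x, has_deriv (U v) x (W v x)) -> has_deriv (after_jump U v) y (after_jump W v y).
Proof.
move=> bU bW dU; have [mW [M WM]] := bW.
apply: (@int_has_deriv _ _ _ (sig v) (fun y z => U v (y + z)) (fun z => W v (y + z)) y M).
- by move=> x; exact: after_jump_row.
- by case: (after_jump_row v y bW).
- move=> x z; have E : x + z - (y + z) = x - y by ring.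
  by rewrite -E; apply: (has_deriv_lip dU) => w; exact: (WM (v, w)).
- by apply: aeW => z; exact: (has_deriv_shift (dU (y + z))).
Qed.

Lemma after_jump_continuous W v : bdm2 W -> continuous (W v) -> continuous (after_jump W v).
Proof.
move=> bW cW y; have [mW [M WM]] := bW.
apply: (@int_continuous_at _ _ _ (sig v) (fun y z => W v (y + z)) y M).
- by move=> x; case: (after_jump_row v x bW).
- by move=> x z; exact: (WM (v, x + z)).
- apply: aeW => z; apply: (continuous_comp (f := fun x : R => x + z)).
    by apply: cvgD; [exact: cvg_id|exact: cvg_cst].
  exact: cW.
Qed.

Lemma weight_true_false s x v :
  weight true s x v = weight false s x v * (v - s < x)%R%:R.
Proof.
by rewrite /weight /= andbT; case: (_ <= v <= T); case: (v - s < x);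
  rewrite ?mul1r ?mul0r ?mulr1 ?mulr0.
Qed.

Lemma weight_false_cst s x y v : weight false s x v = weight false s y v.
Proof. by []. Qed.

Lemma ae_L_neq s x : {ae L, forall v : R, x != v - s}.
Proof.
apply: (ae_mono _ (tmeas_ae_neq T (x + s))) => v; apply: contra => /eqP ->.
by rewrite subrK.
Qed.

(** Differentiating the map of the stopped process in the starting point gives the
    map of the killed process: the terms in which the path has reached the origin
    do not depend on x any more. *)
Lemma picard_has_deriv G G' U W s x : bdm2 U -> bdm2 W ->
  (forall v y, has_deriv (U v) y (W v y)) ->
  has_deriv (G s) x (G' s x) ->
  has_deriv (picard false G U s) x (picard true G' W s x).
Proof.
move=> bU bW dU dG; have [mW [M WM]] := bW.
suff dI : has_deriv (fun y => \int[L]_v (weight false s y v * after_jump U v (Num.max (y - (v - s)) 0)))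
    x (\int[L]_v (weight true s x v * after_jump W v (Num.max (x - (v - s)) 0))).
  apply/has_derivP.
  by have := @is_deriveD R R R _ _ x 1 _ _ ((has_derivP _ _ _).1 dG) ((has_derivP _ _ _).1 dI).
have M0 : 0 <= M := le_trans (normr_ge0 _) (WM (0, 0)).
apply: (@int_has_deriv _ _ _ L
  (fun y v => weight false s y v * after_jump U v (Num.max (y - (v - s)) 0))
  (fun v => weight true s x v * after_jump W v (Num.max (x - (v - s)) 0)) x (a * M)).
- by move=> y; exact: bdm_integrand_row.
- by case: (bdm_integrand_row true s x bW).
- move=> y v; rewrite (weight_false_cst s y x) -mulrBr normrM -mulrA.
  apply: ler_pM => //; first exact: weight_norm.
  have := @has_deriv_lip R (after_jump U v) (after_jump W v) M _ _ (Num.max (x - (v - s)) 0)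
    (Num.max (y - (v - s)) 0).
  move=> /(_ (fun z => after_jump_has_deriv z bU bW (dU v))) h.
  apply: le_trans (h _) _.
    by move=> z; apply: after_jump_norm => // w; exact: (WM (v, w)).
  rewrite ler_wpM2l// (le_trans (max0_lip _ _))//.
  by rewrite (_ : y - (v - s) - (x - (v - s)) = y - x)//; ring.
- apply: (ae_mono _ (ae_L_neq s x)) => v xv.
  have h := has_deriv_max (fun z => after_jump_has_deriv z bU bW (dU v)) xv.
  rewrite weight_true_false -mulrA; apply/has_derivP.
  rewrite (_ : (fun y => _) = (weight false s x v \*:
    (fun y => after_jump U v (Num.max (y - (v - s)) 0)))); last by [].
  exact: (@is_deriveZ R R R _ (weight false s x v) x 1 _ ((has_derivP _ _ _).1 h)).
Qed.

(** For almost every v the killed integrand is continuous at x: its indicator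
    jumps at v = x + s only. *)
Lemma picard_continuous G W s : bdm2 W -> (forall v, continuous (W v)) ->
  continuous (G s) -> continuous (picard true G W s).
Proof.
move=> bW cW cG x; have [mW [M WM]] := bW.
apply: cvgD; first exact: cG.
apply: (@int_continuous_at _ _ _ L
  (fun y v => weight true s y v * after_jump W v (Num.max (y - (v - s)) 0)) x (a * M)).
- by move=> y; case: (bdm_integrand_row true s y bW).
- move=> y v; rewrite normrM; apply: ler_pM => //; first exact: weight_norm.
  by apply: after_jump_norm => // w; exact: (WM (v, w)).
apply: (ae_mono _ (ae_L_neq s x)) => v xv.
have cK : {for x, continuous (fun y => after_jump W v (Num.max (y - (v - s)) 0))}.
  apply: (continuous_comp (f := fun y : R => Num.max (y - (v - s)) 0)).
    apply/cvgrPdist_le => e e0; exists e => //= y yd.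
    rewrite (le_trans (max0_lip _ _))//.
    by rewrite (_ : x - (v - s) - (y - (v - s)) = x - y) ?ltW//; ring.
  exact: after_jump_continuous.
move: xv; rewrite neq_lt => /orP[xv|xv].
- apply/cvgrPdist_le => e e0; exists (v - s - x); first by rewrite /= subr_gt0.
  move=> y /=; rewrite ltr_norml => /andP[yx _].
  rewrite !weight_true_false [v - s < x]ltNge (ltW xv)/=.
  rewrite [v - s < y]ltNge (_ : y <= v - s); last by lra.
  by rewrite !mulr0 !mul0r subrr normr0 ltW.
- have nb : \forall y \near x, v - s < y.
    exists (x - (v - s)); first by rewrite /= subr_gt0.
    by move=> y /=; rewrite ltr_norml => /andP[_ yx]; lra.
  have /cvgrPdist_le h : weight false s x v * after_jump W v (Num.max (y - (v - s)) 0) @[y --> x]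
      --> weight false s x v * after_jump W v (Num.max (x - (v - s)) 0).
    by apply: cvgM; [exact: cvg_cst|exact: cK].
  apply/cvgrPdist_le => e e0; apply: filterS2 nb (h _ e0) => y vy hy.
  by rewrite !weight_true_false xv vy !mulr1; exact: hy.
Qed.

Lemma iterate_has_deriv G G' n s x : bdm2 G -> bdm2 G' ->
  (forall v, continuous (G' v)) -> (forall v y, has_deriv (G v) y (G' v y)) ->
  has_deriv (iterate false G n s) x (iterate true G' n s x) /\
  continuous (iterate true G' n s).
Proof.
move=> bG bG' cG' dG; elim: n s x => [|n IH] s x; first by split; [exact: dG|exact: cG'].
have bU := bdm2_iterate false n bG; have bW := bdm2_iterate true n bG'.
split.
  by apply: (picard_has_deriv bU bW) => // v y; have [] := IH v y.
by apply: (picard_continuous bW) => // v; have [] := IH v 0.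
Qed.

End picard.

(** * The forward equation *)

Lemma itv_int_bound {R : realType} (b1 b2 : bool) (t t' : R) (h : R -> R) (M : R) :
  t <= t' ->
  lebesgue_measure.-integrable [set` Interval (BSide b1 t) (BSide b2 t')] (EFin \o h) ->
  (forall s, [set` Interval (BSide b1 t) (BSide b2 t')] s -> `|h s| <= M) ->
  `|\int[lebesgue_measure]_(s in [set` Interval (BSide b1 t) (BSide b2 t')]) h s| <=
    M * (t' - t).
Proof.
move=> tt' ih hM; set A := [set` _] in ih hM *.
have mA : measurable (A : set (measurableTypeR R)) by exact: measurable_itv.
have lA : lebesgue_measure (A : set (measurableTypeR R)) = (t' - t)%:E.
  rewrite lebesgue_measure_itv/= lte_fin; case: ltP => // t't.
  by rewrite (@le_anti _ _ t t') ?subrr// tt' t't.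
apply: (le_trans (le_normr_Rintegral mA ih)).
rewrite -[t' - t]/(fine (t' - t)%:E) -lA -Rintegral_cst//; apply: le_Rintegral => //.
- by have := integrable_abse ih; apply: eq_integrable.
- apply: (measurable_bounded_integrable (f := fun=> M)) => //.
    by rewrite [X in (X < _)%E](_ : _ = (t' - t)%:E) ?ltry.
  exists `|M|; split; first exact: num_real.
  by move=> y My s _ /=; exact: ltW.
Qed.

Section forward_equation.
Context {R : realType}.
Notation leb := (@lebesgue_measure R).
Variables (a : R) (q : posdist R) (mu : R -> borel_prob R).
Hypotheses (a_ge0 : 0 <= a) (mu_CDR : generalized_CDR a q mu).

(** Jump law at time s, frozen before time 0 so that it is a kernel on R. *)
Definition jump_law (s : R) : borel_prob R := qmix q (mu (Num.max s 0)).

Lemma jump_lawE s : 0 <= s -> jump_law s = qmix q (mu s).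
Proof. by move=> s0; rewrite /jump_law max_l. Qed.

Lemma on_Rplus_jump_law s : on_Rplus (jump_law s).
Proof.
by apply: on_Rplus_qmix; apply: mu_CDR.1; rewrite le_max lexx orbT.
Qed.

(** The CDR equation makes the pairings of mu with the smooth steps differentiable
    in time. *)
Lemma meas_family_jump_law : meas_family jump_law.
Proof.
apply: (@meas_family_qmix R _ _ q (fun s : R => mu (Num.max s 0))).
apply: meas_family_tstep => [s|b n b0].
  by apply: mu_CDR.1; rewrite le_max lexx orbT.
have muR (s : R) : on_Rplus (mu (Num.max s 0)).
  by apply: mu_CDR.1; rewrite le_max lexx orbT.
under eq_fun do rewrite -(pairingE (muR _) (bdm_tstep b n)).
apply: (is_deriv_Rplus_measurable (h := fun s => pairing (mu s) (tstep b n))).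
move=> t t0; eexists; exact: (mu_CDR.2 (tstep b n) (bC1_star_tstep n b0) t t0).
Qed.

Variables (nu : R -> borel_prob R) (r x : R).
Hypothesis r_ge0 : 0 <= r.
Hypotheses (nuR : forall t, r <= t -> on_Rplus (nu t)).
Hypotheses (nu0 : forall B, measurable B -> nu r B = \d_x B).
Hypotheses (nu_mild : mild_solution a q mu r nu).

Let sig_R s : r <= s -> on_Rplus (qmix q (mu s)).
Proof. by move=> rs; apply/on_Rplus_qmix/mu_CDR.1/(le_trans r_ge0). Qed.

Lemma bdm_shift (c : R) (G : R -> R) : bdm G -> bdm (shift_op c G).
Proof.
move=> bG; apply: (bdm_comp (phi := fun y : R => Num.max (y - c) 0)) bG.
by apply: measurable_maxr => //; exact: measurable_funB.
Qed.

Lemma pairing_init (G : R -> R) : bdm G -> pairing (nu r) G = G x.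
Proof.
move=> bG; rewrite (pairingE (nuR (lexx r)) bG) /Rintegral.
rewrite (@eq_measure_integral _ _ _ setT (\d_(x : measurableTypeR R) : borel_prob R)); last first.
  by move=> A mA _; exact: nu0.
rewrite integral_dirac//=; last by case: bG => mG _; exact/measurable_EFinP.
by rewrite indicE in_setT mul1r.
Qed.

Lemma pairing_conv s (G : R -> R) : r <= s -> bdm G ->
  pairing (convolve (nu s) (qmix q (mu s))) G =
  \int[nu s]_y \int[jump_law s]_z G (y + z).
Proof.
move=> rs bG; rewrite pairingE//; last by apply: on_Rplus_conv; [exact: nuR|exact: sig_R].
by rewrite (@convolve_int R _ _ G bG) (jump_lawE (le_trans r_ge0 rs)).
Qed.

(** The mild equation, rewritten with plain integrals over the line and with the
    convolution undone. *)
Lemma forward_equation (G : R -> R) v : bdm G -> r <= v ->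
  \int[nu v]_y G y = expR (a * (r - v)) * G (Num.max (x - (v - r)) 0) +
  a * \int[leb]_(s in `[r, v]) (expR (a * (s - v)) *
    \int[nu s]_y \int[jump_law s]_z G (Num.max (y + z - (v - s)) 0)).
Proof.
move=> bG rv; rewrite -(pairingE (nuR rv) bG).
have [_ ->] := nu_mild (bdm_bBorel bG) rv.
rewrite pairing_init; last exact: bdm_shift.
congr (_ + _ * _); apply: eq_Rintegral => s; rewrite inE /= in_itv/= => /andP[rs _].
by rewrite pairing_conv//; exact: bdm_shift.
Qed.

(** The mild equation only provides, for each t, the integrability of an integrand
    that itself depends on t. After multiplication by exp(a t), the dependence on
    t is through the shift of F alone, and the Lipschitz bound on F makes the
    product locally Lipschitz in t. *)
Lemma weak_path_measurable (F : R -> R) (lam : R) : bdm F ->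
  (forall y z, `|F y - F z| <= lam * `|y - z|) -> (forall y, `|F y| <= 1) ->
  measurable_fun setT (fun t : R => \int[nu (Num.max t r)]_y F y).
Proof.
move=> bF lipF F1.
pose k t s := expR (a * s) *
  pairing (convolve (nu s) (qmix q (mu s))) (shift_op (t - s) F).
pose G t := expR (a * t) * \int[nu t]_y F y.
have ik t : r <= t -> leb.-integrable `[r, t] (EFin \o k t).
  move=> rt; have [ig _] := nu_mild (bdm_bBorel bF) rt.
  have mi : measurable (`[r, t]%classic : set (measurableTypeR R)).
    exact: measurable_itv.
  apply: (eq_integrable mi _ _ _ (integrableZl mi (expR (a * t)) ig)) => s _.
  rewrite /= -EFinM; congr EFin.
  by rewrite mulrA -expRD /k; congr (expR _ * _); ring.
have GE t : r <= t -> G t = expR (a * r) * F (Num.max (x - (t - r)) 0) +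
    a * \int[leb]_(s in `[r, t]) k t s.
  move=> rt; rewrite /G -(pairingE (nuR rt) bF).
  have [ig ->] := nu_mild (bdm_bBorel bF) rt.
  rewrite pairing_init; last exact: bdm_shift.
  have mi : measurable (`[r, t]%classic : set (measurableTypeR R)).
    exact: measurable_itv.
  have E := @RintegralZl _ _ _ leb _ _ (expR (a * t)) mi ig.
  rewrite mulrDr mulrA -expRD mulrCA -E.
  congr (expR _ * _ + _ * _); first by ring.
  by apply: eq_Rintegral => s _; rewrite mulrA -expRD /k; congr (expR _ * _); ring.
have lam0 : 0 <= lam.
  by have := le_trans (normr_ge0 _) (lipF 1 0); rewrite subr0 normr1 mulr1.
have convR s : r <= s -> on_Rplus (convolve (nu s) (qmix q (mu s))).
  by move=> rs; apply: on_Rplus_conv; [exact: nuR|exact: sig_R].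
have kle T t s : r <= s -> s <= T -> `|k t s| <= expR (a * T).
  move=> rs sT; rewrite /k normrM -[leRHS]mulr1; apply: ler_pM => //.
    by rewrite ger0_norm ?expR_ge0// ler_expR ler_wpM2l.
  rewrite (pairingE (convR _ rs)); last exact: bdm_shift.
  by apply: prob_int_norm_le; [exact: bdm_shift|move=> y; exact: F1].
have klip T t t' s : r <= s -> s <= T -> t <= t' ->
    `|k t' s - k t s| <= expR (a * T) * (lam * (t' - t)).
  move=> rs sT tt'; rewrite /k -mulrBr normrM; apply: ler_pM => //.
    by rewrite ger0_norm ?expR_ge0// ler_expR ler_wpM2l.
  rewrite !(pairingE (convR _ rs)); [|exact: bdm_shift..].
  rewrite -bdm_intB; [|exact: bdm_shift..].
  apply: prob_int_norm_le; first by apply: bdmB; exact: bdm_shift.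
  move=> y; apply: (le_trans (lipF _ _)); rewrite ler_wpM2l//.
  rewrite (le_trans (max0_lip _ _))// (_ : _ - _ = t - t'); last by ring.
  by rewrite distrC ger0_norm ?subr_ge0.
have mG : measurable_fun setT (fun t : R => G (Num.max t r)).
  apply: (locally_lipschitz_measurable (G := G)) => T.
  exists (expR (a * r) * lam + a * (expR (a * T) * lam * `|T - r| + expR (a * T))).
  move=> t t' rt tt' t'T.
  have rt' := le_trans rt tt'; have d0 : 0 <= t' - t by rewrite subr_ge0.
  have tT := le_trans tt' t'T.
  have m1 : measurable (`[r, t]%classic : set (measurableTypeR R)) by exact: measurable_itv.
  have m2 : measurable (`]t, t']%classic : set (measurableTypeR R)) by exact: measurable_itv.
  have s1 : `[r, t]%classic `<=` (`[r, t']%classic : set (measurableTypeR R)).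
    by move=> s /=; rewrite !in_itv/= => /andP[-> st]; exact: le_trans tt'.
  have s2 : `]t, t']%classic `<=` (`[r, t']%classic : set (measurableTypeR R)).
    move=> s /=; rewrite !in_itv/= => /andP[ts ->]; rewrite andbT.
    by rewrite (le_trans rt)// ltW.
  have ik' := ik _ rt'.
  have i1 : leb.-integrable `[r, t] (EFin \o k t').
    by apply: integrableS ik' => //; exact: measurable_itv.
  have i2 : leb.-integrable `]t, t'] (EFin \o k t').
    by apply: integrableS ik' => //; exact: measurable_itv.
  have i3 : leb.-integrable `[r, t] (EFin \o (fun s => k t' s - k t s)).
    have := integrableB m1 i1 (ik _ rt).
    by apply: eq_integrable.
  have I1 : \int[leb]_(s in `[r, t']) k t' s - \int[leb]_(s in `[r, t]) k t s =
      \int[leb]_(s in `[r, t]) (k t' s - k t s) + \int[leb]_(s in `]t, t']) k t' s.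
    rewrite RintegralB//; last exact: ik.
    have E := @Rintegral_itvB R (k t') (BLeft r) (BRight t') t ik'.
    rewrite -E ?bnd_simp//.
    by rewrite [RHS]addrC addrA subrK.
  have sub4 (A B C D : R) : A + B - (C + D) = (A - C) + (B - D) by ring.
  rewrite (GE _ rt') (GE _ rt) sub4 -!mulrBr I1.
  apply: (le_trans (ler_normD _ _)); rewrite mulrDl; apply: lerD.
    rewrite normrM ger0_norm ?expR_ge0// -mulrA ler_wpM2l ?expR_ge0//.
    apply: (le_trans (lipF _ _)); rewrite ler_wpM2l//.
    rewrite (le_trans (max0_lip _ _))// (_ : _ - _ = t - t'); last by ring.
    by rewrite distrC ger0_norm.
  rewrite normrM ger0_norm// -mulrA ler_wpM2l//.
  apply: (le_trans (ler_normD _ _)); rewrite mulrDl; apply: lerD.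
    apply: (@le_trans _ _ (expR (a * T) * (lam * (t' - t)) * (t - r))).
      apply: itv_int_bound => // s /=; rewrite in_itv/= => /andP[rs st].
      by apply: klip => //; exact: le_trans tT.
    rewrite -!mulrA ler_wpM2l ?expR_ge0// ler_wpM2l// mulrC ler_wpM2r//.
    by rewrite (le_trans _ (ler_norm _))// lerB.
  apply: itv_int_bound => // s /=; rewrite in_itv/= => /andP[ts st].
  by apply: kle; [rewrite (le_trans rt)// ltW|exact: le_trans t'T].
rewrite (_ : (fun t => _) = fun t => expR (- (a * Num.max t r)) * G (Num.max t r)).
  apply: measurable_funM => //; apply: measurableT_comp => //.
  apply: measurableT_comp => //; apply: measurable_funM => //.
  exact: measurable_maxr.
by apply/funext => t; rewrite /G mulrA -expRD addNr expR0 mul1r.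
Qed.

Lemma meas_family_path : meas_family (fun t : R => nu (Num.max t r)).
Proof.
apply: meas_family_tstep => [t|b n b0].
  by apply: nuR; rewrite le_max lexx orbT.
apply: (@weak_path_measurable (tstep b n) (2 * n.+1%:R)).
- exact: bdm_tstep.
- by move=> y z; exact: tstep_lip.
- exact: tstep_norm.
Qed.

End forward_equation.

(** * Duality of the forward equation and the Picard map *)

Section duality.
Context {R : realType}.
Variables (a T : R) (q : posdist R) (mu : R -> borel_prob R).
Hypotheses (a_ge0 : 0 <= a) (mu_CDR : generalized_CDR a q mu).
Notation sig := (jump_law q mu).
Notation L := (tmeas T).
Notation K := (after_jump sig).

Let msig : meas_family sig.
Proof. exact: (@meas_family_jump_law R a q mu mu_CDR). Qed.

Variables (nu : R -> borel_prob R) (r x : R).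
Hypotheses (r_ge0 : 0 <= r) (rT : r <= T).
Hypotheses (nuR : forall t, r <= t -> on_Rplus (nu t)).
Hypotheses (nu0 : forall B, measurable B -> nu r B = \d_x B).
Hypotheses (nu_mild : mild_solution a q mu r nu).

(* nu, frozen before time r so that it is a kernel on R *)
Let rho (s : R) : borel_prob R := nu (Num.max s r).

Let mrho : meas_family rho.
Proof.
exact: (@meas_family_path R a q mu a_ge0 mu_CDR nu r x r_ge0 nuR nu0 nu_mild).
Qed.

Let bdm2K W : bdm2 W -> bdm2 (K W).
Proof. by move=> bW; apply: bdm2_after_jump. Qed.

Let bdmK W v : bdm2 W -> bdm (K W v).
Proof. by move=> bW; apply: bdm2_row; exact: bdm2K. Qed.

Let rhoE s : r <= s -> rho s = nu s.
Proof. by move=> rs; rewrite /rho max_l. Qed.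

(* mean of W(s, .) just after a jump at time s, when the position before the
   jump has law [rho s] *)
Let N (W : R -> R -> R) (s : R) : R := \int[rho s]_y K W s y.

Let bdm_N W : bdm2 W -> bdm (N W).
Proof. by move=> bW; apply: bdm_family_int => //; exact: bdm2K. Qed.

Let NB W V s : bdm2 W -> bdm2 V -> N (fun s y => W s y - V s y) s = N W s - N V s.
Proof.
move=> bW bV; rewrite /N -bdm_intB; [|exact: bdmK..].
by apply: eq_Rintegral => y _; exact: after_jumpB.
Qed.

Let N_norm W s (M : R) : bdm2 W -> (forall y, `|W s y| <= M) -> `|N W s| <= M.
Proof.
move=> bW WM; apply: prob_int_norm_le; first exact: bdmK.
by move=> y; exact: after_jump_norm.
Qed.

Variables (U : R -> R -> R).
Hypothesis bU : bdm2 U.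

(* mean of U(v, .) after a second jump at time v, when a first one at time s led
   from y to y + z *)
Let cell (s v y z : R) : R := K U v (Num.max (y + z - (v - s)) 0).

Let bdm_cell d (X : measurableType d) (f1 f2 f3 f4 : X -> R) :
  measurable_fun setT f1 -> measurable_fun setT f2 -> measurable_fun setT f3 ->
  measurable_fun setT f4 -> bdm (fun p => cell (f1 p) (f2 p) (f3 p) (f4 p)).
Proof.
move=> m1 m2 m3 m4; rewrite /cell.
apply: (bdm2_comp (f := f2)
  (g := fun p => Num.max (f3 p + f4 p - (f2 p - f1 p)) 0) (bdm2K bU)) => //.
apply: measurable_maxr => //; apply: measurable_funB; first exact: measurable_funD.
exact: measurable_funB.
Qed.

Let m (s v : R) : R := \int[rho s]_y \int[sig s]_z cell s v y z.

Let bdm_cell_z : bdm (fun p : (R * R) * R => \int[sig p.1.1]_z cell p.1.1 p.1.2 p.2 z).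
Proof.
apply: (bdm_family_int (l := fun p : (R * R) * R => sig p.1.1)
  (g := fun (p : (R * R) * R) z => cell p.1.1 p.1.2 p.2 z)).
  move=> A mA; apply: (measurableT_comp (msig mA)).
  exact: measurableT_comp measurable_fst measurable_fst.
apply: bdm_cell.
- apply: (measurableT_comp measurable_fst); apply: (measurableT_comp measurable_fst).
  exact: measurable_fst.
- apply: (measurableT_comp measurable_snd); apply: (measurableT_comp measurable_fst).
  exact: measurable_fst.
- by apply: (measurableT_comp measurable_snd); exact: measurable_fst.
- exact: measurable_snd.
Qed.

Let bdm_m : bdm2 m.
Proof.
apply: (bdm_family_int (l := fun p : R * R => rho p.1)
  (g := fun (p : R * R) y => \int[sig p.1]_z cell p.1 p.2 y z)).
  by move=> A mA; apply: (measurableT_comp (mrho mA)); exact: measurable_fst.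
exact: bdm_cell_z.
Qed.

Let w (s v : R) : R := weight a T false s 0 v.

Let bdm_w : bdm2 w.
Proof.
apply: (bdm_comp (g := fun z : (R * R) * R => weight a T false z.1.1 z.1.2 z.2)
  (phi := fun p : R * R => ((p.1, 0), p.2)) _ (bdm_weight T a_ge0 false)).
apply: measurable_fun_pair; last exact: measurable_snd.
by apply: measurable_fun_pair; [exact: measurable_fst|exact: measurable_cst].
Qed.

Let I (s y : R) : R :=
  \int[L]_v (weight a T false s y v * K U v (Num.max (y - (v - s)) 0)).

Let bdm_I : bdm2 I.
Proof.
exact: (bdm_int_param (g := fun p v => weight a T false p.1 p.2 v *
  K U v (Num.max (p.2 - (v - p.1)) 0)) L (bdm_integrand T a_ge0 msig false bU)).
Qed.

Let bdm_cell_zy s v : bdm (fun y : R => \int[sig s]_z cell s v y z).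
Proof.
apply: (bdm_comp (g := fun p : (R * R) * R => \int[sig p.1.1]_z cell p.1.1 p.1.2 p.2 z)
  (phi := fun y : R => ((s, v), y)) _ bdm_cell_z).
exact: pair1_measurable.
Qed.

Let N_I s : N I s = \int[L]_v (w s v * m s v).
Proof.
rewrite /N.
have E y : K I s y = \int[L]_v (w s v * \int[sig s]_z cell s v y z).
  rewrite /after_jump /I.
  rewrite (@bdm_fubini _ _ _ _ R (sig s) L (fun z v => w s v * cell s v y z)).
    apply: eq_Rintegral => v _; apply: bdm_intZl.
    exact: (@bdm_cell _ _ (fun=> s) (fun=> v) (fun=> y) id).
  apply: bdmM.
    by apply: (@bdm2_comp _ w _ _ (fun=> s) snd bdm_w); [exact: measurable_cst|exact: measurable_snd].
  apply: (@bdm_cell _ _ (fun=> s) snd (fun=> y) fst).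
  - exact: measurable_cst.
  - exact: measurable_snd.
  - exact: measurable_cst.
  - exact: measurable_fst.
under eq_Rintegral do rewrite E.
rewrite (@bdm_fubini _ _ _ _ R (rho s) L
  (fun y v => w s v * \int[sig s]_z cell s v y z)).
  by apply: eq_Rintegral => v _; apply: bdm_intZl; exact: bdm_cell_zy.
apply: bdmM.
  by apply: (@bdm2_comp _ w _ _ (fun=> s) snd bdm_w); [exact: measurable_cst|exact: measurable_snd].
apply: (bdm_comp (g := fun p : (R * R) * R => \int[sig p.1.1]_z cell p.1.1 p.1.2 p.2 z)
  (phi := fun p : R * R => ((s, p.2), p.1)) _ bdm_cell_z).
apply: measurable_fun_pair; last exact: measurable_fst.
by apply: measurable_fun_pair; [exact: measurable_cst|exact: measurable_snd].
Qed.

Let on (b : bool) : R := b%:R.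

Let bdm_on d (X : measurableType d) (f1 f2 f3 : X -> R) :
  measurable_fun setT f1 -> measurable_fun setT f2 -> measurable_fun setT f3 ->
  bdm (fun p => on ((f1 p <= f2 p) && (f2 p <= f3 p))).
Proof.
move=> m1 m2 m3; apply: bdm_bool.
by apply: measurable_and; exact: measurable_fun_ler.
Qed.

Let bdm_onc b c : bdm (fun s : R => on ((b <= s) && (s <= c))).
Proof. exact: (@bdm_on _ _ (fun=> b) id (fun=> c)). Qed.

Let bdm_exp v : bdm (fun s : R => on ((r <= s) && (s <= v)) * expR (a * (s - v))).
Proof.
split.
  apply: measurable_funM; first by case: (bdm_onc r v).
  apply: measurableT_comp => //; apply: measurable_funM => //.
  exact: measurable_funB.
exists 1 => s; rewrite /on; case: (boolP (_ && _)) => [/andP[_ sv]|_].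
  rewrite mul1r ger0_norm ?expR_ge0// -expR0 ler_expR.
  by rewrite mulr_ge0_le0// subr_le0.
by rewrite mul0r normr0.
Qed.

Let wE s v : r <= s -> w s v = on ((s <= v) && (v <= T)) * (a * expR (a * (s - v))).
Proof. by move=> rs; rewrite /w /weight /= andbT max_l// (le_trans r_ge0). Qed.

(* forward equation for the function [K U v] at time v: the last jump before v
   happens at s *)
Let forward_cell v : r <= v -> v <= T ->
  N U v = expR (a * (r - v)) * K U v (Num.max (x - (v - r)) 0) +
  \int[L]_s (on ((r <= s) && (s <= T)) * (w s v * m s v)).
Proof.
move=> rv vT; rewrite /N rhoE//.
rewrite (forward_equation mu_CDR r_ge0 nuR nu0 nu_mild (bdmK v bU) rv); congr (_ + _).
rewrite (tmeas_int _ r_ge0 vT).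
transitivity (a * \int[L]_s (on ((r <= s) && (s <= v)) * expR (a * (s - v)) * m s v)).
  congr (_ * _); apply: eq_Rintegral => s _; rewrite /on.
  case: (boolP (_ && _)) => [/andP[rs _]|_]; last by rewrite !mul0r.
  by rewrite !mul1r /m rhoE.
rewrite -bdm_intZl; last first.
  apply: bdmM; first exact: bdm_exp.
  by apply: (@bdm2_comp _ m _ _ id (fun=> v) bdm_m); [exact: measurable_id|exact: measurable_cst].
apply: eq_Rintegral => s _; rewrite /on; have [rs|] := boolP (r <= s); last by rewrite /= !mul0r mulr0.
rewrite (wE _ rs) vT /= andbT /on; have [sv|] := boolP (s <= v); last by rewrite /= !mul0r !mulr0.
by rewrite (le_trans sv vT) /= !mul1r mulrA.
Qed.

Variables (F : R -> R) (G : R -> R -> R).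
Hypotheses (bF : bdm F) (bG : bdm2 G).
Hypothesis GE : forall s y, 0 <= s -> s <= T ->
  G s y = expR (a * (s - T)) * F (Num.max (y - (T - s)) 0).

Let V := picard a T sig false G U.

Let bV : bdm2 V.
Proof. exact: (bdm2_picard T a_ge0 msig false bG bU). Qed.

Let bdm_onN W (b : R) : bdm2 W -> bdm (fun s : R => on ((b <= s) && (s <= T)) * N W s).
Proof. by move=> bW; apply: bdmM; [exact: bdm_onc|exact: bdm_N]. Qed.

Let N_G s : r <= s -> s <= T -> N G s =
  expR (a * (s - T)) * \int[nu s]_y \int[sig s]_z F (Num.max (y + z - (T - s)) 0).
Proof.
move=> rs sT; have s0 := le_trans r_ge0 rs.
have bFs : bdm (fun y : R => F (Num.max (y - (T - s)) 0)).
  exact: (bdm_shift (T - s) bF).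
have E y : K G s y =
    expR (a * (s - T)) * \int[sig s]_z F (Num.max (y + z - (T - s)) 0).
  rewrite /after_jump -bdm_intZl; first by apply: eq_Rintegral => z _; rewrite GE.
  apply: (bdm_comp (g := fun y : R => F (Num.max (y - (T - s)) 0))
    (phi := fun z : R => y + z)) bFs.
  exact: measurable_funD.
rewrite /N rhoE//; under eq_Rintegral do rewrite E.
apply: bdm_intZl.
apply: (@bdm_family_int _ _ (measurableTypeR R) (measurableTypeR R) R (fun=> sig s)
  (fun y z => F (Num.max (y + z - (T - s)) 0))).
  by move=> A mA; exact: measurable_cst.
apply: (bdm_comp (g := fun y : R => F (Num.max (y - (T - s)) 0))
    (phi := fun z : R * R => z.1 + z.2)) bFs.
by apply: measurable_funD; [exact: measurable_fst|exact: measurable_snd].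
Qed.

Let forward_F : \int[nu T]_y F y =
  G r x + a * \int[L]_s (on ((r <= s) && (s <= T)) * N G s).
Proof.
rewrite (forward_equation mu_CDR r_ge0 nuR nu0 nu_mild bF rT) GE//.
rewrite (tmeas_int _ r_ge0 (lexx T)); congr (_ + _ * _).
apply: eq_Rintegral => s _; rewrite /on.
case: (boolP (_ && _)) => [/andP[rs sT]|_]; last by rewrite !mul0r.
by rewrite !mul1r N_G.
Qed.

(* [forward_cell] integrated over v, after Fubini on the triangle r <= s <= v <= T *)
Let swap_I : a * \int[L]_s (on ((r <= s) && (s <= T)) * N I s) =
  a * \int[L]_s (on ((r <= s) && (s <= T)) * N U s) - I r x.
Proof.
pose Z v : R := expR (a * (r - v)) * K U v (Num.max (x - (v - r)) 0).
have bZ : bdm (fun v => on ((r <= v) && (v <= T)) * Z v).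
  rewrite (_ : (fun v => _) = fun v => (on ((r <= v) && (v <= T)) * expR (a * (r - v))) *
      K U v (Num.max (x - (v - r)) 0)); last by apply/funext => v; rewrite mulrA.
  apply: bdmM; last first.
    apply: (@bdm2_comp _ (K U) _ _ id (fun v : R => Num.max (x - (v - r)) 0) (bdm2K bU)).
      exact: measurable_id.
    by apply: measurable_maxr => //; apply: measurable_funB => //; exact: measurable_funB.
  split.
    apply: measurable_funM; first by case: (bdm_onc r T).
    apply: measurableT_comp => //; apply: measurable_funM => //.
    exact: measurable_funB.
  exists 1 => v; rewrite /on; case: (boolP (_ && _)) => [/andP[rv _]|_].
    rewrite mul1r ger0_norm ?expR_ge0// -expR0 ler_expR.
    by rewrite mulr_ge0_le0// subr_le0.
  by rewrite mul0r normr0.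
have IE : I r x = a * \int[L]_v (on ((r <= v) && (v <= T)) * Z v).
  rewrite -bdm_intZl//; apply: eq_Rintegral => v _.
  by rewrite /weight /Z /on (max_l r_ge0) /= andbT; ring.
rewrite IE -mulrBr; congr (_ * _).
rewrite -bdm_intB; [|exact: bdm_onN|exact: bZ].
transitivity (\int[L]_s \int[L]_v (on ((r <= s) && (s <= T)) * (w s v * m s v))).
  apply: eq_Rintegral => s _; rewrite N_I; apply/esym; apply: bdm_intZl.
  by apply: bdmM; [exact: (bdm2_row s bdm_w)|exact: (bdm2_row s bdm_m)].
rewrite (@bdm_fubini _ _ _ _ R L L
  (fun s v => on ((r <= s) && (s <= T)) * (w s v * m s v))); last first.
  apply: bdmM; last by apply: bdmM; [exact: bdm_w|exact: bdm_m].
  apply: (@bdm_on _ _ (fun=> r) fst (fun=> T)).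
  - exact: measurable_cst.
  - exact: measurable_fst.
  - exact: measurable_cst.
apply: eq_Rintegral => v _; have [/andP[rv vT]|nv] := boolP ((r <= v) && (v <= T)).
  by rewrite !mul1r forward_cell// addrAC subrr add0r.
rewrite !mul0r subrr; transitivity (\int[L]_s (0 : R)).
  apply: eq_Rintegral => s _; rewrite {1}/on; have [/andP[rs sT]|_] := boolP ((r <= s) && (s <= T)).
    rewrite (wE _ rs) /on (_ : (s <= v) && (v <= T) = false) ?mul0r ?mulr0//.
    apply/negbTE; apply: contra nv => /andP[sv ->]; rewrite andbT.
    exact: le_trans sv.
  by rewrite mul0r.
by rewrite Rintegral_cst// mul0r.
Qed.

(** If U were a fixed point of the backward map, then U(r, x) would be the integral
    of F against nu_T. In general the difference is a time integral of the mean
    of V - U after a jump: write G = V - I in the forward equation for F, and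
    use the forward equation once more, at each time v, to recognize the
    contribution of I. *)
Lemma duality (M : R) : (forall s y, `|V s y - U s y| <= M) ->
  `|\int[nu T]_y F y - V r x| <= a * (M * fine (L setT)).
Proof.
move=> VU.
have -> : \int[nu T]_y F y - V r x =
    a * \int[L]_s (on ((r <= s) && (s <= T)) * N (fun s y => V s y - U s y) s).
  have GVI : G = (fun s y => V s y - I s y).
    by apply/funext => s; apply/funext => y; rewrite /V /picard addrK.
  have NGE s : N G s = N V s - N I s by rewrite {1}GVI NB.
  rewrite forward_F; under eq_Rintegral do rewrite NGE mulrBr.
  rewrite bdm_intB; [|exact: bdm_onN..].
  transitivity (a * (\int[L]_s (on ((r <= s) && (s <= T)) * N V s) -
      \int[L]_s (on ((r <= s) && (s <= T)) * N U s))).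
    have key (A B C g i : R) : a * B = a * C - i -> g + a * (A - B) - (g + i) = a * (A - C).
      by move=> e; rewrite !mulrBr e; ring.
    exact: key swap_I.
  congr (_ * _); rewrite -bdm_intB; [|exact: bdm_onN..].
  by apply: eq_Rintegral => s _; rewrite NB// mulrBr.
rewrite normrM ger0_norm// ler_wpM2l//; apply: int_norm_le_cst.
  by apply: bdm_onN; exact: bdmB.
move=> s; rewrite normrM -[leRHS]mul1r; apply: ler_pM => //.
  by rewrite /on; case: (_ && _); rewrite ?normr1 ?normr0.
by apply: N_norm; [exact: bdmB|move=> y; exact: VU].
Qed.

End duality.

(** * The backward equation of one Picard step *)

Section backward_identity.
Context {R : realType}.
Notation leb := (@lebesgue_measure R).
Variables (a T : R) (sig : R -> borel_prob R).
Hypotheses (a_ge0 : 0 <= a) (msig : meas_family sig).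
Notation L := (tmeas T).
Notation K := (after_jump sig).
Variables (U W Gu Gw : R -> R -> R) (F F' : R -> R).
Hypotheses (bU : bdm2 U) (bW : bdm2 W) (bGu : bdm2 Gu) (bGw : bdm2 Gw).
Hypotheses (dU : forall v y, has_deriv (U v) y (W v y)).
Hypotheses (cW : forall v, continuous (W v)).
Hypotheses (dF : forall y, has_deriv F y (F' y)) (cF' : continuous F').
Hypothesis GuE : forall s y, 0 <= s -> s <= T ->
  Gu s y = expR (a * (s - T)) * F (Num.max (y - (T - s)) 0).
Hypothesis GwE : forall s y, 0 <= s -> s <= T ->
  Gw s y = expR (a * (s - T)) *
    ((T - s < y)%R%:R * F' (Num.max (y - (T - s)) 0)).
Variables (r x : R).
Hypotheses (r_ge0 : 0 <= r) (rT : r <= T) (x_ge0 : 0 <= x).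

Let V := picard a T sig false Gu U.
Let V' := picard a T sig true Gw W.
Let on (s : R) : R := ((r <= s) && (s <= T))%R%:R.
Let J (s : R) := \int[L]_v (weight a T false s x v * K U v (Num.max (x - (v - s)) 0)).
Let J' (s : R) := \int[L]_v (weight a T true s x v * K W v (Num.max (x - (v - s)) 0)).

Let bdm_row (A : R -> R -> R) : bdm2 A -> bdm (fun s => A s x).
Proof.
by move=> bA; apply: (@bdm2_comp _ A _ _ id (fun=> x) bA); [exact: measurable_id|exact: measurable_cst].
Qed.

Let bdm_ron : bdm on.
Proof.
apply: bdm_bool; apply: measurable_and; apply: measurable_fun_ler;
  by [exact: measurable_id|exact: measurable_cst].
Qed.

Let bdm_JJ (j : bool) (A : R -> R -> R) : bdm2 A ->
  bdm2 (fun s v => weight a T j s x v * K A v (Num.max (x - (v - s)) 0)).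
Proof.
move=> bA; apply: (bdm_comp (g := fun z : (R * R) * R => weight a T j z.1.1 z.1.2 z.2 *
    K A z.2 (Num.max (z.1.2 - (z.2 - z.1.1)) 0))
  (phi := fun p : R * R => ((p.1, x), p.2))); last exact: bdm_integrand.
apply: measurable_fun_pair; last exact: measurable_snd.
by apply: measurable_fun_pair; [exact: measurable_fst|exact: measurable_cst].
Qed.

Let bdm_J : bdm J.
Proof. exact: (bdm_int_param L (bdm_JJ false bU)). Qed.

Let bdm_J' : bdm J'.
Proof. exact: (bdm_int_param L (bdm_JJ true bW)). Qed.

(* the integrand in v of a J + J': for fixed v it is the integrand in s of the
   fundamental theorem for [K U v] along the stopped drift *)
Let cell (s v : R) : R :=
  weight a T false s x v * (a * K U v (Num.max (x - (v - s)) 0)) +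
  weight a T true s x v * K W v (Num.max (x - (v - s)) 0).

Let cellE s v : cell s v =
  a * (weight a T false s x v * K U v (Num.max (x - (v - s)) 0)) +
  weight a T true s x v * K W v (Num.max (x - (v - s)) 0).
Proof. by rewrite /cell; ring. Qed.

Let bdm_cell : bdm2 cell.
Proof.
rewrite (_ : cell = fun s v =>
  a * (weight a T false s x v * K U v (Num.max (x - (v - s)) 0)) +
  weight a T true s x v * K W v (Num.max (x - (v - s)) 0)).
  by apply: bdmD; [apply: bdmM; [exact: bdm_cst|exact: bdm_JJ]|exact: bdm_JJ].
by apply/funext => s; apply/funext => v; exact: cellE.
Qed.

Let cell_v s : \int[L]_v cell s v = a * J s + J' s.
Proof.
under eq_Rintegral do rewrite cellE.
rewrite bdm_intD ?bdm_intZl//; try exact: (bdm2_row s (bdm_JJ _ _)).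
by apply: bdmM; [exact: bdm_cst|exact: (bdm2_row s (bdm_JJ _ _))].
Qed.

Let cell_s v : r <= v -> v <= T ->
  \int[L]_s (on s * cell s v) =
  a * (K U v x - expR (a * (r - v)) * K U v (Num.max (x - (v - r)) 0)).
Proof.
move=> rv vT.
have dK z : has_deriv (K U v) z (K W v z) by exact: after_jump_has_deriv.
have cK : continuous (K W v) by exact: after_jump_continuous.
rewrite -(kink_FTC a dK cK rv x_ge0).
rewrite (tmeas_int _ r_ge0 vT) -bdm_intZl.
- apply: eq_Rintegral => s _; rewrite /on /cell weight_true_false.
  have [rs|nrs] := boolP (r <= s); last by rewrite /= !mul0r mulr0.
  rewrite /weight (max_l (le_trans r_ge0 rs)) vT andbT /=.
  have [sv|nsv] := boolP (s <= v); last by rewrite /= !mul0r addr0 !mulr0.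
  by rewrite (le_trans sv vT) /=; ring.
- pose B (s : R) := ((r <= s) && (s <= v))%R%:R * expR (a * (s - v)).
  have bB : bdm B.
    split.
      apply: measurable_funM.
        apply: measurable_bool; apply: measurable_and; apply: measurable_fun_ler;
          by [exact: measurable_id|exact: measurable_cst].
      apply: measurableT_comp => //; apply: measurable_funM => //.
      exact: measurable_funB.
    exists 1 => s; rewrite /B; case: (boolP (_ && _)) => [/andP[_ sv]|_].
      rewrite mul1r ger0_norm ?expR_ge0// -expR0 ler_expR.
      by rewrite mulr_ge0_le0// subr_le0.
    by rewrite mul0r normr0.
  rewrite (_ : (fun s : R => _) = fun s => B s * (a * K U v (Num.max (x - (v - s)) 0) +
    (v - s < x)%R%:R * K W v (Num.max (x - (v - s)) 0))); last first.
    by apply/funext => s; rewrite /B mulrA.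
  have mm : measurable_fun setT (fun s : R => Num.max (x - (v - s)) 0).
    by apply: measurable_maxr => //; apply: measurable_funB => //; exact: measurable_funB.
  have bK (A : R -> R -> R) : bdm2 A -> bdm (fun s : R => K A v (Num.max (x - (v - s)) 0)).
    move=> bA; apply: (@bdm2_comp _ (K A) _ _ (fun=> v) (fun s : R => Num.max (x - (v - s)) 0)
      (bdm2_after_jump msig bA)) => //.
  apply: bdmM => //; apply: bdmD; first by apply: bdmM; [exact: bdm_cst|exact: bK].
  apply: bdmM; last exact: bK.
  by apply: bdm_bool; apply: measurable_fun_ltr => //; exact: measurable_funB.
Qed.

Let bdm_KUx : bdm (fun v => K U v x).
Proof. exact: (bdm_row (bdm2_after_jump msig bU)). Qed.

Let swapped : \int[L]_s (on s * (a * J s + J' s)) =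
  \int[L]_v (on v * (a * K U v x)) - J r.
Proof.
transitivity (\int[L]_s \int[L]_v (on s * cell s v)).
  apply: eq_Rintegral => s _; rewrite -cell_v; apply/esym; apply: bdm_intZl.
  exact: (bdm2_row s bdm_cell).
rewrite (@bdm_fubini _ _ _ _ R L L (fun s v => on s * cell s v)); last first.
  apply: bdmM; last exact: bdm_cell.
  by apply: (bdm_comp (g := on)) => //; exact: measurable_fst.
rewrite /J -bdm_intB; last 2 first.
- by apply: bdmM => //; apply: bdmM => //; exact: bdm_cst.
- exact: (bdm2_row r (bdm_JJ false bU)).
apply: eq_Rintegral => v _; have [/andP[rv vT]|nv] := boolP ((r <= v) && (v <= T)).
  rewrite cell_s// /weight (max_l r_ge0) /on rv vT /=; ring.
rewrite /weight (max_l r_ge0) /= {2}/on (negbTE nv) /= !mul0r subrr.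
transitivity (\int[L]_s (0 : R)).
  apply: eq_Rintegral => s _; rewrite /on; have [/andP[rs sT]|_] := boolP ((r <= s) && (s <= T));
    last by rewrite mul0r.
  rewrite /cell /weight (max_l (le_trans r_ge0 rs)) (_ : (s <= v) && (v <= T) = false).
    by rewrite /= !mul0r addr0 mulr0.
  apply/negbTE; apply: contra nv => /andP[sv ->]; rewrite andbT.
  exact: le_trans sv.
by rewrite Rintegral_cst// mul0r.
Qed.

(* the same theorem for F, between r and T *)
Let boundary : \int[L]_s (on s * (a * Gu s x + Gw s x)) = F x - Gu r x.
Proof.
rewrite (GuE x r_ge0 rT) -(kink_FTC a dF cF' rT x_ge0).
rewrite (tmeas_int _ r_ge0 (lexx T)); apply: eq_Rintegral => s _; rewrite /on.
case: (boolP (_ && _)) => [/andP[rs sT]|_]; last by rewrite !mul0r.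
by rewrite (GuE x (le_trans r_ge0 rs) sT) (GwE x (le_trans r_ge0 rs) sT); ring.
Qed.

(** V' is the space derivative of V, so that aV + V' integrated over s is, up to
    Fubini, an integral of exact differentials along the stopped drift, one for
    each jump time v and one for the terminal function; the boundary terms at
    s = v give the jump part a K U, those at s = r give V(r, x). *)
Lemma backward_step : V r x = F x +
  \int[leb]_(s in `[r, T]) (a * K U s x - a * V s x - V' s x).
Proof.
rewrite (tmeas_int _ r_ge0 (lexx T)).
have bV : bdm2 V by exact: (bdm2_picard T a_ge0 msig false bGu bU).
have bV' : bdm2 V' by exact: (bdm2_picard T a_ge0 msig true bGw bW).
have E1 : \int[L]_s (on s * (a * K U s x - a * V s x - V' s x)) =
    \int[L]_v (on v * (a * K U v x)) -
    (\int[L]_s (on s * (a * J s + J' s)) + \int[L]_s (on s * (a * Gu s x + Gw s x))).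
  have b1 : bdm (fun s => on s * (a * J s + J' s)).
    by apply: bdmM => //; apply: bdmD => //; apply: bdmM => //; exact: bdm_cst.
  have b2 : bdm (fun s => on s * (a * Gu s x + Gw s x)).
    apply: bdmM => //; apply: bdmD; last exact: (bdm_row bGw).
    by apply: bdmM; [exact: bdm_cst|exact: (bdm_row bGu)].
  have b3 : bdm (fun v => on v * (a * K U v x)).
    by apply: bdmM => //; apply: bdmM => //; exact: bdm_cst.
  rewrite -(bdm_intD L b1 b2) -(bdm_intB L b3 (bdmD b1 b2)).
  apply: eq_Rintegral => s _.
  rewrite (_ : V s x = Gu s x + J s)// (_ : V' s x = Gw s x + J' s)//.
  by move: (J s) (J' s) (K U s x) => A B C; ring.
rewrite -/(on _) in E1 *.
transitivity (F x + \int[L]_s (on s * (a * K U s x - a * V s x - V' s x))); last by [].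
rewrite E1 swapped boundary (_ : V r x = Gu r x + J r)//.
by move: (J r) (\int[L]_v _) => A B; ring.
Qed.

End backward_identity.

(** * Passage to the limit *)

Section geometric_limits.
Context {R : realType}.

Lemma geometric_limit (X : nat -> R) (D c : R) : 0 <= c < 1 ->
  (forall n, `|X n.+1 - X n| <= D * c ^+ n) ->
  X n @[n --> \oo] --> limn X /\ forall n, `|X n - limn X| <= D / (1 - c) * c ^+ n.
Proof.
move=> /andP[c0 c1] hX; have c1' : 0 < 1 - c by rewrite subr_gt0.
have D0 : 0 <= D by have := hX 0%N; rewrite expr0 mulr1; exact: le_trans.
pose e n := D / (1 - c) * c ^+ n.
have tail n k : `|X (n + k)%N - X n| <= D / (1 - c) * (c ^+ n - c ^+ (n + k)%N).
  elim: k => [|k IH]; first by rewrite addn0 !subrr normr0 mulr0.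
  rewrite addnS (_ : X (n + k).+1 - X n = (X (n + k).+1 - X (n + k)%N) + (X (n + k)%N - X n));
    last by rewrite addrA subrK.
  apply: (le_trans (ler_normD _ _)); apply: (le_trans (lerD (hX _) IH)).
  rewrite le_eqVlt; apply/orP; left; apply/eqP; rewrite exprS; field.
  by rewrite gt_eqF.
have taile n k : `|X (n + k)%N - X n| <= e n.
  apply: (le_trans (tail n k)); rewrite /e ler_wpM2l//; first by rewrite divr_ge0// ltW.
  by rewrite gerBl exprn_ge0.
have e0 : e n @[n --> \oo] --> 0.
  by apply: cvg_geometric; rewrite ger0_norm.
have cX : cvgn X.
  apply: cauchy_cvg; apply: cauchy_exP => eps eps0.
  have /cvgrPdist_lt /(_ _ eps0) [N _ /(_ N (leqnn N)) /=] := e0.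
  rewrite sub0r normrN => eN; exists (X N); exists N => // n /= Nn.
  rewrite -(subnKC Nn) -ball_normE /= distrC.
  by apply: le_lt_trans (taile _ _) _; exact: le_lt_trans (ler_norm _) eN.
split=> // n; rewrite distrC -/(e n).
have cXn : X (n + k)%N @[k --> \oo] --> limn X.
  rewrite (_ : (fun k => X (n + k)%N) = (fun k => X (k + n)%N)); last first.
    by apply/funext => k; rewrite addnC.
  by rewrite (cvg_shiftn n X).
have : `|X (n + k)%N - X n| @[k --> \oo] --> `|limn X - X n|.
  by apply: cvg_norm; apply: cvgB => //; exact: cvg_cst.
move=> hl; apply: (ler_cvg_to hl (cvg_cst (e n))).
by apply: nearW => k; exact: taile.
Qed.

End geometric_limits.

Section terminal_data.
Context {R : realType}.
Variables (a T : R) (f : R -> R).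
Hypotheses (a_ge0 : 0 <= a) (f_C1 : bC1_star f).

(** Contribution of the paths without a jump between s and T. Times s > T are
    clipped in the exponential to keep the factor bounded. *)
Definition nojump (g : R -> R) (s y : R) : R :=
  expR (a * Num.min (s - T) 0) * g (y - (T - s)).

Let factor_le1 (s : R) : `|expR (a * Num.min (s - T) 0)| <= 1.
Proof.
rewrite ger0_norm ?expR_ge0// -expR0 ler_expR mulr_ge0_le0//.
by rewrite ge_min lexx orbT.
Qed.

Lemma nojump_norm g (B : R) s y : (forall z, `|g z| <= B) -> `|nojump g s y| <= B.
Proof. by move=> gB; rewrite normrM -[leRHS]mul1r; exact: ler_pM. Qed.

Lemma bdm2_nojump g : bdm g -> bdm2 (nojump g).
Proof.
move=> bg.
have m1 : measurable_fun setT (fun z : R * R => z.1) := measurable_fst.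
have m2 : measurable_fun setT (fun z : R * R => z.2) := measurable_snd.
apply: bdmM.
  split; last by exists 1 => z; exact: factor_le1.
  apply: measurableT_comp; first exact: measurable_expR.
  apply: measurable_funM; first exact: measurable_cst.
  apply: measurable_minr; last exact: measurable_cst.
  by apply: measurable_funB; [exact: m1|exact: measurable_cst].
apply: (bdm_comp (g := g) (phi := fun z : R * R => z.2 - (T - z.1))) bg.
apply: measurable_funB; first exact: m2.
by apply: measurable_funB; [exact: measurable_cst|exact: m1].
Qed.

Lemma nojump_has_deriv s y : has_deriv (nojump (fext f) s) y (nojump (dext f) s y).
Proof.
have h : has_deriv (fun y => fext f (y - (T - s))) y (dext f (y - (T - s))).
  exact: (has_deriv_shift (has_deriv_fext f_C1 (y - (T - s)))).
apply/has_derivP.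
exact: (@is_deriveZ R R R _ (expR (a * Num.min (s - T) 0)) y 1 _ ((has_derivP _ _ _).1 h)).
Qed.

Lemma nojump_continuous g s : continuous g -> continuous (nojump g s).
Proof.
move=> cg y; apply: cvgM; first exact: cvg_cst.
apply: (continuous_comp (f := fun y : R => y - (T - s))); last exact: cg.
by apply: cvgB; [exact: cvg_id|exact: cvg_cst].
Qed.

Lemma nojump_fextE s y : s <= T ->
  nojump (fext f) s y = expR (a * (s - T)) * fext f (Num.max (y - (T - s)) 0).
Proof.
move=> sT; rewrite /nojump min_l ?subr_le0//; congr (_ * _).
by rewrite /fext; congr f; case: (leP (y - (T - s)) 0) => ?; rewrite ?maxxx// max_l// ltW.
Qed.

Lemma nojump_dextE s y : s <= T ->
  nojump (dext f) s y = expR (a * (s - T)) *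
    ((T - s < y)%R%:R * dext f (Num.max (y - (T - s)) 0)).
Proof.
move=> sT; rewrite /nojump min_l ?subr_le0//; congr (_ * _).
case: (ltP (T - s) y) => ys; first by rewrite mul1r max_l// subr_ge0 ltW.
by rewrite mul0r dext_le0// subr_le0.
Qed.

End terminal_data.

Section limit.
Context {R : realType}.
Variables (a : R) (q : posdist R) (mu : R -> borel_prob R)
  (P : R -> R -> R -> borel_prob R).
Hypotheses (a_ge0 : 0 <= a) (mu_CDR : generalized_CDR a q mu)
  (P_transition : transition_family a q mu P).
Variables (T : R) (f : R -> R).
Hypotheses (T_ge0 : 0 <= T) (f_C1 : bC1_star f).
Notation leb := (@lebesgue_measure R).
Notation sig := (jump_law q mu).
Notation K := (after_jump sig).

Let msig : meas_family sig.
Proof. exact: (@meas_family_jump_law R a q mu mu_CDR). Qed.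

Let gu := nojump a T (fext f).
Let gw := nojump a T (dext f).
Let U := iterate a T sig false gu.
Let W := iterate a T sig true gw.
Let c := 1 - expR (- (a * T)).

Let bgu : bdm2 gu. Proof. exact: (bdm2_nojump T a_ge0 (bdm_fext f_C1)). Qed.
Let bgw : bdm2 gw. Proof. exact: (bdm2_nojump T a_ge0 (bdm_dext f_C1)). Qed.
Let bU n : bdm2 (U n). Proof. exact: (bdm2_iterate T a_ge0 msig false n bgu). Qed.
Let bW n : bdm2 (W n). Proof. exact: (bdm2_iterate T a_ge0 msig true n bgw). Qed.

Let c01 : 0 <= c < 1. Proof. exact: contraction_rate. Qed.

Let dUW n s y : has_deriv (U n s) y (W n s y).
Proof.
have [] := @iterate_has_deriv R a T sig a_ge0 msig gu gw n s y bgu bgw => //.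
- by move=> v; apply: nojump_continuous; exact: continuous_dext.
- by move=> v z; exact: nojump_has_deriv.
Qed.

Let cW n s : continuous (W n s).
Proof.
have [] := @iterate_has_deriv R a T sig a_ge0 msig gu gw n s 0 bgu bgw => //.
- by move=> v; apply: nojump_continuous; exact: continuous_dext.
- by move=> v z; exact: nojump_has_deriv.
Qed.

Let bound : exists B, (forall s y, `|gu s y| <= B) /\ (forall s y, `|gw s y| <= B).
Proof.
have [_ [/= M1 h1]] := bdm_fext f_C1; have [_ [/= M2 h2]] := bdm_dext f_C1.
exists (Num.max M1 M2); split=> s y; apply: nojump_norm => // z.
- by rewrite le_max h1.
- by rewrite le_max h2 orbT.
Qed.

Let u s y := limn (fun n => U n s y).
Let w s y := limn (fun n => W n s y).

Let rates : exists D, [/\ 0 <= D,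
  forall n s y, `|U n.+1 s y - U n s y| <= D * c ^+ n,
  forall n s y, `|U n s y - u s y| <= D / (1 - c) * c ^+ n,
  forall n s y, `|W n s y - w s y| <= D / (1 - c) * c ^+ n &
  forall n s y, `|U n s y| <= D /\ `|W n s y| <= D].
Proof.
have [B [guB gwB]] := bound.
have B0 : 0 <= B := le_trans (normr_ge0 _) (guB 0 0).
have /andP[c0 c1] := c01; have d0 : 0 < 1 - c by rewrite subr_gt0.
have Bd0 : 0 <= B / (1 - c) by rewrite divr_ge0// ltW.
have rU n s y : `|U n.+1 s y - U n s y| <= 2 * (B / (1 - c)) * c ^+ n.
  exact: (iterate_cauchy a_ge0 T_ge0 msig false n s y bgu guB).
have rW n s y : `|W n.+1 s y - W n s y| <= 2 * (B / (1 - c)) * c ^+ n.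
  exact: (iterate_cauchy a_ge0 T_ge0 msig true n s y bgw gwB).
exists (2 * (B / (1 - c))); split => //.
- by rewrite mulr_ge0.
- move=> n s y; exact: (geometric_limit c01 (fun n => rU n s y)).2.
- move=> n s y; exact: (geometric_limit c01 (fun n => rW n s y)).2.
- move=> n s y; rewrite mulr_natl mulr2n; split.
  + apply: (le_trans (iterate_bound a_ge0 T_ge0 msig false n s y bgu guB)).
    by rewrite lerDl.
  + apply: (le_trans (iterate_bound a_ge0 T_ge0 msig true n s y bgw gwB)).
    by rewrite lerDl.
Qed.

Let geom0 (D : R) : D * c ^+ n @[n --> \oo] --> 0.
Proof. by apply: cvg_geometric; case/andP: c01 => c0 c1; rewrite ger0_norm. Qed.

Let dist_cvg (X : nat -> R) (l : R) (e : nat -> R) : (forall n, `|X n - l| <= e n) ->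
  e n @[n --> \oo] --> 0 -> X n @[n --> \oo] --> l.
Proof.
move=> Xe /cvgrPdist_le e0; apply/cvgrPdist_le => eps eps0.
apply: filterS (e0 _ eps0) => n; rewrite sub0r normrN => h.
by rewrite distrC (le_trans (Xe n))// (le_trans (ler_norm _)).
Qed.

Let U_cvg s y : U n s y @[n --> \oo] --> u s y.
Proof. by have [D [_ _ h _ _]] := rates; exact: (dist_cvg (fun n => h n s y) (geom0 _)). Qed.

Let W_cvg s y : W n s y @[n --> \oo] --> w s y.
Proof. by have [D [_ _ _ h _]] := rates; exact: (dist_cvg (fun n => h n s y) (geom0 _)). Qed.

Let U_cvgS s y : U n.+1 s y @[n --> \oo] --> u s y.
Proof. by rewrite (cvg_shiftS (fun n => U n s y)); exact: U_cvg. Qed.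

Let W_cvgS s y : W n.+1 s y @[n --> \oo] --> w s y.
Proof. by rewrite (cvg_shiftS (fun n => W n s y)); exact: W_cvg. Qed.

Let bu : bdm2 u.
Proof.
have [D [_ _ _ _ h]] := rates.
apply: (@bdm_cvg _ _ R (fun n (z : R * R) => U n z.1 z.2) _ D).
- by move=> n; case: (bU n).
- by move=> n z; case: (h n z.1 z.2).
- by move=> z; exact: U_cvg.
Qed.

(* [duality] along the iterates: the error term decays geometrically *)
Let transition_limit s y : 0 <= s -> s <= T -> 0 <= y -> transition_op P s T f y = u s y.
Proof.
move=> s0 sT y0; have [PR P0 Pm] := P_transition s0 y0.
have [D [D0 h _ _ _]] := rates.
have -> : transition_op P s T f y = \int[P s T y]_z fext f z.
  rewrite /transition_op pairing_posE//; first exact: PR.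
  have [[[M fM] cf _ _ _] _] := f_C1; split; last by exists M.
  by apply: subspace_continuous_measurable_fun => //; exact: measurable_Rplus.
have key n := @duality R a T q mu a_ge0 mu_CDR (fun v => P s v y) s y s0 sT
  PR P0 Pm (U n) (bU n) (fext f) gu (bdm_fext f_C1) bgu
  (fun s y _ sT => @nojump_fextE R a T f s y sT) (D * c ^+ n) (h n).
have : U n.+1 s y @[n --> \oo] --> \int[P s T y]_z fext f z.
  apply: (dist_cvg (e := fun n => a * (D * fine (tmeas T setT)) * c ^+ n)); last exact: geom0.
  move=> n; rewrite distrC (le_trans (key n))//.
  by rewrite le_eqVlt; apply/orP; left; apply/eqP; ring.
by move=> h1; apply: (cvg_unique _ h1) => //; exact: U_cvgS.
Qed.

(* the derivatives of the iterates converge uniformly *)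
Let deriv_limit s y : 0 <= s -> s <= T -> 0 <= y ->
  deriv_Rplus (transition_op P s T f) y = w s y.
Proof.
move=> s0 sT y0; have [D [_ _ _ h _]] := rates.
apply: is_deriv_Rplus_lim => //.
apply: (@has_deriv_limit R (fun n => U n s) (fun n => W n s) _ (w s)
  (fun n => D / (1 - c) * c ^+ n)) => //.
- by move=> z z0; rewrite transition_limit//; exact: U_cvg.
- apply: (@uniform_limit_continuous R (fun n => W n s) (w s)
    (fun n => D / (1 - c) * c ^+ n)) => //.
Qed.

(* This is why the indicator of x > 0 in the generator can be dropped: a path at
   the origin is killed at once. *)
Let w0 s : 0 <= s -> s <= T -> w s 0 = 0.
Proof.
move=> s0 sT; have W0 n : W n s 0 = 0.
  have g0 : gw s 0 = 0.
    by rewrite /gw nojump_dextE// ltNge subr_ge0 sT/= mul0r mulr0.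
  case: n => [|n]; first exact: g0.
  rewrite /W /= /picard -/gw g0 add0r.
  transitivity (\int[tmeas T]_v (0 : R)); last by rewrite Rintegral_cst// mul0r.
  apply: eq_Rintegral => v _; rewrite weight_true_false /weight (max_l s0) /=.
  have [sv|_] := boolP (s <= v); last by rewrite /= !mul0r.
  by rewrite [v - s < 0]ltNge subr_ge0 sv/= mulr0 mul0r.
rewrite /w (_ : (fun n => W n s 0) = fun=> 0); last by apply/funext.
exact: lim_cst.
Qed.

(* integrands of the backward equations of the iterates *)
Let h_ n s x : R := a * K (U n) s x - a * U n.+1 s x - W n.+1 s x.

Let generator_limit s x : 0 <= s -> s <= T -> 0 <= x ->
  h_ n s x @[n --> \oo] --> generator a q mu s (transition_op P s T f) x.
Proof.
move=> s0 sT x0; have [D [D0 _ hu _ _]] := rates.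
have -> : generator a q mu s (transition_op P s T f) x = a * K u s x - a * u s x - w s x.
  rewrite /generator deriv_limit//.
  have -> : w s x * (0 < x)%R%:R = w s x.
    move: x0; rewrite le_eqVlt => /predU1P[<-|->]; last by rewrite mulr1.
    by rewrite w0// mul0r.
  rewrite -jump_lawE//; congr (_ - _).
  have brow : bdm (fun z : R => u s (x + z)) by exact: after_jump_row.
  have -> : pairing (sig s) (fun z => transition_op P s T f (x + z) - transition_op P s T f x) =
      pairing (sig s) (fun z => u s (x + z) - u s x).
    apply: eq_Rintegral => z; rewrite inE Rplus_ge0 => z0.
    by rewrite !transition_limit// addr_ge0.
  rewrite pairingE; last 2 first.
  - exact: (on_Rplus_jump_law mu_CDR).
  - by apply: bdmB => //; exact: bdm_cst.
  rewrite bdm_intB//; last exact: bdm_cst.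
  have e1 : fine (sig s setT) = 1 by rewrite (probability_setT (sig s)).
  by rewrite Rintegral_cst// e1 mulr1 mulrBr.
have cK : K (U n) s x @[n --> \oo] --> K u s x.
  apply: (dist_cvg (e := fun n => D / (1 - c) * c ^+ n)); last exact: geom0.
  move=> n.
  have <- : K (fun v z => U n v z - u v z) s x = K (U n) s x - K u s x.
    by apply: after_jumpB; [exact: bU|exact: bu].
  apply: after_jump_norm; first by apply: bdmB; [exact: bU|exact: bu].
  by move=> z; exact: hu.
apply: cvgB; last exact: W_cvgS.
apply: cvgB; first by apply: cvgM => //; exact: cvg_cst.
apply: cvgM; first exact: cvg_cst.
exact: U_cvgS.
Qed.

Let backward_iterate n r x : 0 <= r -> r <= T -> 0 <= x ->
  U n.+1 r x = f x + \int[leb]_(s in `[r, T]) h_ n s x.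
Proof.
move=> r0 rT x0.
have := @backward_step R a T sig a_ge0 msig (U n) (W n) gu gw (fext f) (dext f)
  (bU n) (bW n) bgu bgw (dUW n) (@cW n) (has_deriv_fext f_C1) (@continuous_dext R f f_C1)
  (fun s y _ sT => @nojump_fextE R a T f s y sT) (fun s y _ sT => @nojump_dextE R a T f f_C1 s y sT)
  r x r0 rT x0.
by rewrite {1}/fext max_l.
Qed.

(** Limit of [backward_step] along the iterates, dominated by their common bound;
    measurability in s of the generator term comes with the limit. *)
Lemma backward_equation r x : 0 <= r -> r <= T -> 0 <= x ->
  let h s := generator a q mu s (transition_op P s T f) x in
  leb.-integrable `[r, T] (EFin \o h) /\
  transition_op P r T f x = f x + \int[leb]_(s in `[r, T]) h s.
Proof.
move=> r0 rT x0 h; have [D [D0 _ _ _ hD]] := rates.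
have mI : measurable (`[r, T]%classic : set (measurableTypeR R)) by exact: measurable_itv.
have bh n : bdm (fun s => h_ n s x).
  have row (A : R -> R -> R) : bdm2 A -> bdm (fun s => A s x).
    by move=> bA; apply: (@bdm2_comp _ A _ _ id (fun=> x) bA); [exact: measurable_id|exact: measurable_cst].
  apply: bdmB; last exact: row.
  apply: bdmB; first by apply: bdmM; [exact: bdm_cst|exact: (row _ (bdm2_after_jump msig (bU n)))].
  by apply: bdmM; [exact: bdm_cst|exact: row].
have mh n : measurable_fun (`[r, T]%classic : set (measurableTypeR R)) (EFin \o (h_ n ^~ x)).
  by apply/measurable_EFinP; apply: measurable_funTS; case: (bh n).
have ch s : (`[r, T]%classic : set (measurableTypeR R)) s ->
    (EFin \o (h_ n ^~ x)) s @[n --> \oo] --> (EFin \o h) s.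
  rewrite /= in_itv/= => /andP[rs sT]; apply: cvg_EFin; first exact: nearW.
  exact: (generator_limit (le_trans r0 rs) sT x0).
have hle n s : `|h_ n s x| <= a * D + a * D + D.
  apply: (le_trans (ler_normB _ _)); apply: lerD; last exact: (hD n.+1 s x).2.
  apply: (le_trans (ler_normB _ _)); apply: lerD; rewrite normrM ger0_norm// ler_wpM2l//.
    by apply: after_jump_norm => [//|z]; exact: (hD n s z).1.
  exact: (hD n.+1 s x).1.
have icst : leb.-integrable `[r, T] (fun=> (a * D + a * D + D)%:E).
  by apply: (continuous_itv_integrable (h := fun=> a * D + a * D + D)) => v; exact: cvg_cst.
have hg (s : measurableTypeR R) n : (`[r, T]%classic : set (measurableTypeR R)) s ->
    (`|(EFin \o (h_ n ^~ x)) s| <= (a * D + a * D + D)%:E)%E.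
  by move=> _; rewrite /= lee_fin; exact: hle.
have [ih _ cI] := dominated_convergence mI mh
  (emeasurable_fun_cvg (fun n => EFin \o (h_ n ^~ x)) (EFin \o h) mh (@ch)) (aeW _ (@ch)) icst
  (aeW _ hg).
split; first exact: ih.
have cR : \int[leb]_(s in `[r, T]) h_ n s x @[n --> \oo] --> \int[leb]_(s in `[r, T]) h s.
  rewrite /Rintegral; apply: fine_cvg; rewrite fineK//.
  exact: integrable_fin_num ih.
have cU : U n.+1 r x @[n --> \oo] --> f x + \int[leb]_(s in `[r, T]) h s.
  under eq_fun do rewrite backward_iterate//.
  by apply: cvgD; [exact: cvg_cst|exact: cR].
rewrite transition_limit//.
apply: (cvg_unique _ _ cU) => //.
exact: U_cvgS.
Qed.

End limit.

Theorem proposition4p6 (R : realType) (a : R) (q : posdist R)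
    (mu : R -> borel_prob R) (P : R -> R -> R -> borel_prob R)
    (a_ge0 : 0 <= a)
    (mu_CDR : generalized_CDR a q mu)
    (P_transition : transition_family a q mu P)
    (t : R) (t_ge0 : 0 <= t) (f : R -> R) (f_C1 : bC1_star f)
    (r x : R) (r_ge0 : 0 <= r) (r_le_t : r <= t) (x_ge0 : 0 <= x) :
  let h s := generator a q mu s (transition_op P s t f) x in
  lebesgue_measure.-integrable `[r, t] (EFin \o h) /\
  transition_op P r t f x =
    f x + \int[lebesgue_measure]_(s in `[r, t]) h s.
Proof. exact: (backward_equation a_ge0 mu_CDR P_transition t_ge0 f_C1). Qed.
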